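(* Assume that $\vec{\nu}$ satisfies the regular variation condition with index $\alpha\in(0,1)$. For every integer $n\ge1$ put $v_n^-=2\,\mathbb{E}K_2(n)/n^2$ and $v_n^+=2\,\mathbb{E}K_{\overline{2}}(n)/n^2$. Then the missing mass $M_{n,0}$ (and likewise $M_0(n)$) is sub-Gaussian on the left tail with variance factor $v_n^-$ and sub-gamma on the right tail with variance factor $v_n^+$ and scale factor $1/n$. Moreover, the variance factors satisfy $$\lim_{n\to\infty}\frac{v_n^-}{\operatorname{Var}(M_{n,0})}=\frac{1}{1-2^{\alpha-2}},\qquad \lim_{n\to\infty}\frac{v_n^+}{\operatorname{Var}(M_{n,0})}=\frac{2}{\alpha(1-2^{\alpha-2})},$$ and thus $$\lim_{n\to\infty}\frac{v_n^-}{v_n^+}=\frac{\alpha}{2}.$$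
   Context: Let $(p_j)_{j\ge1}$ be a probability mass function on the positive integers, and let $U_1,U_2,\dots$ be i.i.d. with $\mathbb{P}(U_i=j)=p_j$. Counting function: $\vec{\nu}(x)=|\{j\ge1: p_j\ge x\}|$ for $x>0$. The regular variation condition with index $\alpha$ means $\vec{\nu}(1/x)\sim x^\alpha\ell(x)$ as $x\to\infty$ with $\ell$ slowly varying at infinity, i.e. $\lim_{\tau\to\infty}\ell(\tau x)/\ell(\tau)=1$ for all $x>0$. Binomial setting (sample size $n$): $X_{n,j}=\sum_{i=1}^n \mathbb{I}_{\{U_i=j\}}$; $M_{n,0}=\sum_{j\ge1}p_j\mathbb{I}_{\{X_{n,j}=0\}}$. Poisson setting: the sample size is replaced by a Poisson random variable $N(t)$ with mean $t$, independent of $(U_i)$; $X_j(t)=\sum_{i=1}^{N(t)}\mathbb{I}_{\{U_i=j\}}$; $K_r(t)=\sum_{j\ge1}\mathbb{I}_{\{X_j(t)=r\}}$; $K_{\overline{r}}(t)=\sum_{j\ge1}\mathbb{I}_{\{X_j(t)\ge r\}}$; $M_0(t)=\sum_{j\ge1}p_j\mathbb{I}_{\{X_j(t)=0\}}$. The quantities $K_2(n)$, $K_{\overline{2}}(n)$, $M_0(n)$ are these Poisson quantities at $t=n$. A random variable $Z$ is sub-Gaussian on the left tail with variance factor $v$ if $\log\mathbb{E}e^{\lambda(Z-\mathbb{E}Z)}\le v\lambda^2/2$ for all $\lambda\le0$. It is sub-gamma on the right tail with variance factor $v$ and scale factor $c$ if $\log\mathbb{E}e^{\lambda(Z-\mathbb{E}Z)}\le\frac{\lambda^2v}{2(1-c\lambda)}$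 for all $0\le\lambda<1/c$. *)

(* Defs.v *)
From HB Require Import structures.
From mathcomp Require Import all_boot all_order all_algebra.
From mathcomp Require Import finmap all_classical all_reals all_analysis.

Set Implicit Arguments.
Unset Strict Implicit.
Unset Printing Implicit Defensive.

Import Order.TTheory GRing.Theory Num.Theory.
Import numFieldNormedType.Exports.

Local Open Scope classical_set_scope.
Local Open Scope ring_scope.

Section RegularVariation.
Variable R : realType.

(* p is a probability mass function on {1, 2, ...}: p 0 is never used. *)
Definition is_pmf (p : nat -> R) : Prop :=
  (forall j, (1 <= j)%N -> 0 <= p j) /\
  (\sum_(1 <= j <oo) (p j)%:E = 1)%E.

(* For x > 0 and p a probability mass function the set below is finite, so
   that fset_set (which is fset0 on infinite sets) yields its cardinality. *)
Definition counting_nu (p : nat -> R) (x : R) : R :=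
  #|` fset_set [set j : nat | (1 <= j)%N /\ x <= p j] |%:R.

(* Since x / 0 = 0, this limit forces ell to be eventually nonzero. *)
Definition slowly_varying (ell : R -> R) : Prop :=
  forall x : R, 0 < x -> ell (tau * x) / ell tau @[tau --> +oo] --> (1 : R).

Definition nu_regularly_varying (p : nat -> R) (alpha : R) : Prop :=
  exists2 ell : R -> R, slowly_varying ell &
    counting_nu p (1 / x) / (x `^ alpha * ell x) @[x --> +oo] --> (1 : R).

End RegularVariation.

Section Independence.
Context d (T : measurableType d) (R : realType) (P : probability T R).
Context d' (T' : measurableType d') d'' (T'' : measurableType d'').

Definition mutually_independent (X : nat -> {RV P >-> T'}) : Prop :=
  forall (s : seq nat) (B : nat -> set T'),
    uniq s -> (forall i, measurable (B i)) ->
    P (\bigcap_(i in [set` s]) (X i @^-1` B i)) =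
    (\prod_(i <- s) P (X i @^-1` B i))%E.

Definition sigma_seq (X : nat -> {RV P >-> T'}) : set (set T) :=
  <<s [set A | exists i, exists2 B : set T', measurable B & A = X i @^-1` B] >>.

Definition independent_of_seq (Y : {RV P >-> T''}) (X : nat -> {RV P >-> T'}) :
  Prop :=
  forall (B : set T'') (A : set T), measurable B -> sigma_seq X A ->
    P (Y @^-1` B `&` A) = (P (Y @^-1` B) * P A)%E.

End Independence.

Section UrnScheme.
Context d (T : measurableType d) (R : realType) (P : probability T R).
Variables (p : nat -> R) (U : nat -> {RV P >-> nat}).

(* U i is the (i+1)-st draw. *)
Definition iid_draws : Prop :=
  mutually_independent U /\
  (forall i j, (1 <= j)%N -> P (U i @^-1` [set j]) = (p j)%:E).

Definition poisson_sizes (N : R -> {RV P >-> nat}) : Prop :=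
  forall t : R, 0 < t ->
    (forall k, P (N t @^-1` [set k]) = (poisson_pmf t k)%:E) /\
    independent_of_seq (N t) U.

Definition occupancy (n j : nat) (w : T) : nat := (\sum_(i < n) (U i w == j))%N.

Definition missing_mass (n : nat) (w : T) : R :=
  fine (\sum_(1 <= j <oo) (p j * (occupancy n j w == 0%N)%:R)%:E)%E.

Variable N : R -> {RV P >-> nat}.

Definition poisson_occupancy (t : R) (j : nat) (w : T) : nat :=
  occupancy (N t w) j w.

(* Extended-real valued because the number of empty cells may be infinite. *)
Definition poisson_K (r : nat) (t : R) (w : T) : \bar R :=
  (\sum_(1 <= j <oo) ((poisson_occupancy t j w == r)%:R)%:E)%E.

Definition poisson_Kge (r : nat) (t : R) (w : T) : \bar R :=
  (\sum_(1 <= j <oo) ((r <= poisson_occupancy t j w)%N%:R)%:E)%E.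

Definition poisson_missing_mass (t : R) (w : T) : R :=
  fine (\sum_(1 <= j <oo) (p j * (poisson_occupancy t j w == 0%N)%:R)%:E)%E.

Definition v_minus (n : nat) : R :=
  2 * fine (\int[P]_w poisson_K 2 n%:R w)%E / n%:R ^+ 2.

Definition v_plus (n : nat) : R :=
  2 * fine (\int[P]_w poisson_Kge 2 n%:R w)%E / n%:R ^+ 2.

End UrnScheme.

Section Tails.
Context d (T : measurableType d) (R : realType) (P : probability T R).

(* Integrability makes the centering by the expectation meaningful. *)
Definition sub_gaussian_left (Z : T -> R) (v : R) : Prop :=
  P.-integrable setT (EFin \o Z) /\
  forall lambda : R, lambda <= 0 ->
    (lne 'E_P[fun w => expR (lambda * (Z w - fine 'E_P[Z]))]
      <= (v * lambda ^+ 2 / 2)%:E)%E.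

Definition sub_gamma_right (Z : T -> R) (v c : R) : Prop :=
  P.-integrable setT (EFin \o Z) /\
  forall lambda : R, 0 <= lambda -> lambda < 1 / c ->
    (lne 'E_P[fun w => expR (lambda * (Z w - fine 'E_P[Z]))]
      <= (lambda ^+ 2 * v / (2 * (1 - c * lambda)))%:E)%E.

End Tails.

(* Main.v *)
Require Import Defs.
From HB Require Import structures.
From mathcomp Require Import all_boot all_order all_algebra.
From mathcomp Require Import finmap.
From mathcomp Require Import all_classical all_reals all_analysis.
From mathcomp Require Import measurable_realfun.
From mathcomp Require Import ring lra.
Import Order.TTheory GRing.Theory Num.Theory.
Import numFieldNormedType.Exports.

Local Open Scope classical_set_scope.
Local Open Scope ring_scope.

(* Both tails of the missing mass come from a product bound on its moment
   generating function: the indicators of empty cells are negatively associated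
   in the binomial scheme and independent in the Poisson one, so
   [log E exp(lambda (Z - E Z))] is at most
   [\sum_j exp(- n p_j) (exp(lambda p_j) - 1 - lambda p_j)].
   By Poisson thinning [v_n^- = \sum_j p_j^2 exp(- n p_j)] and
   [v_n^+ = 2 n^-2 \sum_j h(n p_j)] with [h u = 1 - exp(- u) (1 + u)].

   Writing [G t = \sum_j p_j^2 exp(- t p_j)] and [H t = \sum_j h(t p_j)], a
   layer-cake comparison transfers regular variation from the counting function
   to [H], and the bounds
   [u^2 exp(- a u) (a^2 - 1) / 2 <= h(a u) - h u <= u^2 exp(- u) (a^2 - 1) / 2]
   play the role of the monotone density theorem: letting [a] tend to 1 gives
   [t^2 G t / H t --> alpha], hence [G (2 t) / G t --> 2 `^ (alpha - 2)].
   Finally [Var M_n] is [G n - G (2 n)] up to [O(n G(n)^2)] and the error made in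
   replacing [(1 - p_j)^n] by [exp(- n p_j)], and [n G n --> 0]. *)

(** The summand [x ^+ 2 * expR (- (t * x))] of [G] is not monotone in [x], so a one-sided estimate
    of the counting function says nothing about [G] directly. This forces the detour through [H]:
    its summand is increasing, with density [s * expR (- s)], so inequalities between counts
    integrate to inequalities between values of [H]. Regular variation controls the counts only for
    [x >= x0]; the finitely many heavier cells contribute a constant, absorbed because [H] tends to
    infinity.

    Negative association is not taken from a general theory: the joint law of the empty cells is
    encoded in a finite generating function, and induction on the number of draws bounds it. Only
    weights of a common sign are needed, since [expR (lambda * q j) - 1] has the sign of [lambda]
    for every [j].

    The right tail rests on writing [lambda * p_j] as [s * u] with [u = n * p_j] and
    [s = lambda / n < 1]. Then [expR (s * u) - 1 - s * u] is at most [s ^+ 2] times its value at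
    [s = 1], and the factor [expR (- u)] turns [expR u - 1 - u] into exactly [h u]. *)

(** * Real series dominated by the probability weights *)

Section DominatedSeries.
Context {R : realType}.
Variable q : nat -> R.
Hypotheses (q0 : forall j, 0 <= q j) (q1 : series q @ \oo --> (1 : R)).

Definition rsum (a : nat -> R) : R := limn (series a).

(** A single summability criterion for all series of the proof. It makes the total operator [rsum]
    meaningful, because a limit in [R] has no content without convergence. *)
Definition dominated (a : nat -> R) : Prop :=
  exists C : R, forall j, `|a j| <= C * q j.

Lemma pmf_le1 j : q j <= 1.
Proof.
rewrite -(cvg_lim _ q1)//; apply: (@le_trans _ _ (series q j.+1)).
  by rewrite /series /= big_nat_recr//= lerDr sumr_ge0.
apply: nondecreasing_cvgn_le; last by apply/cvg_ex; exists 1.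
by apply: nondecreasing_series => *.
Qed.

Lemma dominated_cvg a : dominated a -> cvgn (series a).
Proof.
move=> [C aC]; apply: normed_cvg.
have C0 : cvgn (series (C *: q)) by apply: is_cvg_seriesZ; apply/cvg_ex; exists 1.
apply: series_le_cvg C0 => [n|n|n] /=; [by []| |exact: aC].
by rewrite (le_trans _ (aC n)).
Qed.

Lemma rsum_cvg a : dominated a -> series a @ \oo --> rsum a.
Proof. exact: dominated_cvg. Qed.

Lemma dominated_self : dominated q.
Proof. by exists 1 => j; rewrite mul1r ger0_norm. Qed.

Lemma dominated_le a b : dominated b -> (forall j, `|a j| <= `|b j|) ->
  dominated a.
Proof. by move=> [C bC] ab; exists C => j; exact: le_trans (ab j) (bC j). Qed.

Lemma dominatedD a b : dominated a -> dominated b ->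
  dominated (fun j => a j + b j).
Proof.
move=> [C aC] [D bD]; exists (C + D) => j; rewrite mulrDl.
by rewrite (le_trans (ler_normD _ _))// lerD.
Qed.

Lemma dominatedZ k a : dominated a -> dominated (fun j => k * a j).
Proof.
move=> [C aC]; exists (`|k| * C) => j; rewrite normrM -mulrA.
by rewrite ler_wpM2l.
Qed.

Lemma dominatedB a b : dominated a -> dominated b ->
  dominated (fun j => a j - b j).
Proof.
move=> da /(dominatedZ (-1)) db; apply: dominated_le (dominatedD _ _ da db) _.
by move=> j; rewrite mulN1r.
Qed.

Lemma rsum_le a b : dominated a -> dominated b -> (forall j, a j <= b j) ->
  rsum a <= rsum b.
Proof. by move=> da db; apply: lim_series_le; exact: dominated_cvg. Qed.

Lemma rsum_ge0 a : dominated a -> (forall j, 0 <= a j) -> 0 <= rsum a.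
Proof.
move=> da a0; apply: limr_ge; first exact: dominated_cvg.
by apply: nearW => n; rewrite /series /= sumr_ge0.
Qed.

Lemma le_rsum a n : dominated a -> (forall j, 0 <= a j) ->
  series a n <= rsum a.
Proof.
move=> da a0; apply: nondecreasing_cvgn_le; last exact: dominated_cvg.
exact: nondecreasing_series.
Qed.

Lemma rsumB a b : dominated a -> dominated b ->
  rsum (fun j => a j - b j) = rsum a - rsum b.
Proof. by move=> da db; apply: lim_seriesB; exact: dominated_cvg. Qed.

Lemma rsumZ k a : dominated a -> rsum (fun j => k * a j) = k * rsum a.
Proof. by move=> da; apply: lim_seriesZ; exact: dominated_cvg. Qed.

Lemma rsum_pmf : rsum q = 1.
Proof. exact: cvg_lim. Qed.

Lemma nneseries_rsum a : dominated a -> (forall j, 0 <= a j) ->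
  (\sum_(0 <= j <oo) (a j)%:E)%E = (rsum a)%:E.
Proof.
move=> da a0; rewrite /rsum -EFin_lim; last exact: dominated_cvg.
by apply: congr_lim; apply/funext => n /=; rewrite sumEFin.
Qed.

End DominatedSeries.

(** * The Poisson tail function and its increments *)

Section PoissonTail.
Context {R : realType}.
Implicit Types u v c : R.

(* The probability that a Poisson variable of mean u is at least 2. *)
Definition ptail2 u : R := 1 - expR (- u) * (1 + u).

(** The derivative of [ptail2] at [s] is [s * expR (- s)]. After subtraction of [c * s ^+ 2] its
    sign on [s >= 0] is that of [expR (- s) - 2 * c], which compares increments of [ptail2] with
    increments of the square. *)
Lemma is_derive_ptail2 c u :
  is_derive u 1 (fun s => ptail2 s - c * s ^+ 2) (u * (expR (- u) - 2 * c)).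
Proof.
rewrite /ptail2; apply: is_derive_eq.
by rewrite /GRing.scale /=; ring.
Qed.

Lemma ptail2_MVT c u v : u <= v -> exists2 w, w \in `[u, v] &
  (ptail2 v - ptail2 u) - c * (v ^+ 2 - u ^+ 2) =
  w * (expR (- w) - 2 * c) * (v - u).
Proof.
move=> uv.
have df x : x \in `]u, v[ -> is_derive x 1 (fun s => ptail2 s - c * s ^+ 2)
    (x * (expR (- x) - 2 * c)) by move=> _; exact: is_derive_ptail2.
have [|w wuv wE] := MVT_segment uv df; last by exists w => //; rewrite -wE; ring.
apply: derivable_within_continuous => x _.
exact: (@ex_derive _ _ _ _ _ _ _ (is_derive_ptail2 c x)).
Qed.

Lemma ptail2_incr_ge c u v : 0 <= u -> u <= v -> 2 * c <= expR (- v) ->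
  c * (v ^+ 2 - u ^+ 2) <= ptail2 v - ptail2 u.
Proof.
move=> u0 uv cv; have [w /itvP wuv wE] := ptail2_MVT c _ _ uv.
have w0 : 0 <= w by rewrite (le_trans u0)// wuv.
rewrite -subr_ge0 wE mulr_ge0 ?subr_ge0// mulr_ge0// subr_ge0.
by rewrite (le_trans cv)// ler_expR lerN2 wuv.
Qed.

Lemma ptail2_incr_le c u v : 0 <= u -> u <= v -> expR (- u) <= 2 * c ->
  ptail2 v - ptail2 u <= c * (v ^+ 2 - u ^+ 2).
Proof.
move=> u0 uv cv; have [w /itvP wuv wE] := ptail2_MVT c _ _ uv.
have w0 : 0 <= w by rewrite (le_trans u0)// wuv.
rewrite -subr_le0 wE mulr_le0_ge0 ?subr_ge0// mulr_ge0_le0// subr_le0.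
by rewrite (le_trans _ cv)// ler_expR lerN2 wuv.
Qed.

Lemma ptail2_0 : ptail2 0 = 0.
Proof. by rewrite /ptail2 oppr0 expR0 mul1r addr0 subrr. Qed.

Lemma ptail2_nondecreasing u v : 0 <= u -> u <= v -> ptail2 u <= ptail2 v.
Proof.
move=> u0 uv; have := @ptail2_incr_ge 0 u v u0 uv.
by rewrite mulr0 mul0r subr_ge0; apply; exact: expR_ge0.
Qed.

Lemma ptail2_ge0 u : 0 <= u -> 0 <= ptail2 u.
Proof. by move=> u0; rewrite -ptail2_0 ptail2_nondecreasing. Qed.

Lemma ptail2_le1 u : 0 <= u -> ptail2 u <= 1.
Proof.
by move=> u0; rewrite /ptail2 lerBlDr lerDl mulr_ge0 ?expR_ge0 ?addr_ge0.
Qed.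

Lemma ptail2_le_sqr u : 0 <= u -> ptail2 u <= u ^+ 2 / 2.
Proof.
move=> u0; have /le_trans -> // : ptail2 u <= 2^-1 * u ^+ 2; last by rewrite mulrC.
have := @ptail2_incr_le 2^-1 0 u (lexx _) u0.
by rewrite ptail2_0 subr0 expr0n subr0 oppr0 expR0 divff//; apply.
Qed.

(** This linear bound makes [ptail2 (t * q j)] summable against [q]; the quadratic bound serves for
    [u <= 1] and the bound 1 beyond. *)
Lemma ptail2_le_id u : 0 <= u -> ptail2 u <= u.
Proof.
move=> u0; have [u1|u1] := leP u 1.
  by apply: le_trans (ptail2_le_sqr _ u0) _; nra.
by rewrite (le_trans (ptail2_le1 _ u0))// ltW.
Qed.

(** On [[u, c * u]] the factor [expR (- s)] is largest at the left endpoint, whence the constant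
    [expR (- u) / 2]; the reverse bound below uses the right endpoint. *)
Lemma ptail2_scale_le c u : 0 <= u -> 1 <= c ->
  ptail2 (c * u) - ptail2 u <= (c ^+ 2 - 1) / 2 * (u ^+ 2 * expR (- u)).
Proof.
move=> u0 c1; have := @ptail2_incr_le (expR (- u) / 2) u (c * u) u0.
rewrite ler_peMl// mulrCA divff// mulr1 => /(_ isT (lexx _)) /le_trans -> //.
by rewrite le_eqVlt; apply/orP; left; apply/eqP; field.
Qed.

Lemma ptail2_scale_ge c u : 0 <= u -> 1 <= c ->
  (c ^+ 2 - 1) / 2 * (u ^+ 2 * expR (- (c * u))) <= ptail2 (c * u) - ptail2 u.
Proof.
move=> u0 c1; have := @ptail2_incr_ge (expR (- (c * u)) / 2) u (c * u) u0.
rewrite ler_peMl// mulrCA divff// mulr1 => /(_ isT (lexx _)).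
by apply: le_trans; rewrite le_eqVlt; apply/orP; left; apply/eqP; field.
Qed.

Lemma ptail2_gt0 u : 0 < u -> 0 < ptail2 u.
Proof.
move=> u0; rewrite /ptail2 subr_gt0 expRN mulrC ltr_pdivrMr ?expR_gt0// mul1r.
by rewrite expR_gt1Dx// gt_eqF.
Qed.

End PoissonTail.

(** * Layer-cake comparison of tail sums through counts *)

Section LayerCake.
Context {R : realType}.
Local Notation mu := (@lebesgue_measure R).

Lemma derivable_ptail2 (u : R) : derivable ptail2 u 1.
Proof.
have := @ex_derive _ _ _ _ _ _ _ (is_derive_ptail2 0 u).
by under eq_fun do rewrite mul0r subr0.
Qed.

Lemma ptail2_derive1 (u : R) : (@ptail2 R)^`()%classic u = u * expR (- u).
Proof.
rewrite derive1E; have := @derive_val _ _ _ _ _ _ _ (is_derive_ptail2 0 u).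
by under eq_fun do rewrite mul0r subr0; move=> ->; rewrite mulr0 subr0.
Qed.

Lemma continuous_ptail2 : continuous (@ptail2 R).
Proof.
by move=> u; apply/differentiable_continuous/derivable1_diffP/derivable_ptail2.
Qed.

Lemma continuous_ptail2_density : continuous (fun s : R => s * expR (- s)).
Proof.
move=> u; apply: cvgM; first exact: cvg_id.
by apply: (@continuous_comp _ _ _ (@GRing.opp R) expR);
  [exact: opp_continuous|exact: continuous_expR].
Qed.

Lemma ptail2_integral (v : R) : 0 <= v ->
  (\int[mu]_(s in `[0%R, v]) (s * expR (- s))%:E = (ptail2 v)%:E)%E.
Proof.
rewrite le_eqVlt => /predU1P[<-|v0].
  by rewrite set_itv1 integral_set1 ptail2_0.
rewrite (@continuous_FTC2 _ _ ptail2)//.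
- by rewrite ptail2_0 sube0.
- by apply: continuous_subspaceT; exact: continuous_ptail2_density.
- split.
  + by move=> x _; exact: derivable_ptail2.
  + by apply: cvg_at_right_filter; exact: continuous_ptail2.
  + by apply: cvg_at_left_filter; exact: continuous_ptail2.
- by move=> x _; exact: ptail2_derive1.
Qed.

Lemma ptail2_layer_cake (b z : R) : 0 <= b -> 0 <= z ->
  (\int[mu]_(s in `[0%R, z]) ((s * expR (- s))%:E * ((s <= b)%R%:R)%:E)
    = (ptail2 (Order.min b z))%:E)%E.
Proof.
move=> b0 z0; rewrite -ptail2_integral ?le_min ?b0//.
have -> : `[0%R, Order.min b z]%classic = `[0%R, z] `&` [set s : R | s <= b].
  apply/seteqP; split => s /=; rewrite !in_itv/= le_min.
    by move=> /and3P[-> -> ->].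
  by move=> [/andP[-> ->] ->].
rewrite integral_mkcondr; apply: eq_integral => s _; rewrite patchE.
by case: ifPn; rewrite ?notin_setE ?inE/= => sb; [rewrite sb mule1|
  move/negP/negbTE : sb => ->; rewrite mule0].
Qed.

Lemma measurable_layer (b z : R) : measurable_fun (`[0%R, z] : set R)
  (fun s : R => (s * expR (- s))%:E * ((s <= b)%R%:R)%:E)%E.
Proof.
apply: emeasurable_funM.
  apply/measurable_EFinP; apply: measurable_funTS; apply: continuous_measurable_fun.
  exact: continuous_ptail2_density.
apply/measurable_EFinP; apply: measurable_funTS.
have -> : (fun s : R => (s <= b)%R%:R : R) = \1_([set s : R | s <= b]).
  apply/funext => s; rewrite indicE; case: (boolP (s <= b)) => sb.
    by rewrite mem_set.
  by rewrite memNset//; apply/negP.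
apply: measurable_indic.
by rewrite (_ : [set _ | _] = `]-oo, b]%classic)//; exact: set_itvNyc.
Qed.

(** By Tonelli each sum is the integral of [s * expR (- s)] against the number of terms that are at
    least [s]. Counts are compared only for [s <= z], hence the truncation of [b j] at [z]. *)
Lemma ptail2_comparison (a b : nat -> R) (c z : R) :
  (forall j, 0 <= a j) -> (forall j, 0 <= b j) -> 0 <= c -> 0 <= z ->
  (forall s, 0 < s <= z -> (\sum_(0 <= j <oo) ((s <= b j)%R%:R)%:E <=
    c%:E * \sum_(0 <= j <oo) ((s <= a j)%R%:R)%:E)%E) ->
  (\sum_(0 <= j <oo) (ptail2 (Order.min (b j) z))%:E <=
     c%:E * \sum_(0 <= j <oo) (ptail2 (a j))%:E)%E.
Proof.
move=> a0 b0 c0 z0 ab.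
have f0 (x s : R) : `[0%R, z]%classic s ->
    (0 <= (s * expR (- s))%:E * ((s <= x)%R%:R)%:E)%E.
  rewrite /= in_itv/= => /andP[s0 _].
  by rewrite -EFinM lee_fin mulr_ge0// mulr_ge0// expR_ge0.
have swap (x : nat -> R) : (forall j, 0 <= x j) ->
    (\sum_(0 <= j <oo) (ptail2 (Order.min (x j) z))%:E =
     \int[mu]_(s in `[0%R, z])
       \sum_(0 <= j <oo) ((s * expR (- s))%:E * ((s <= x j)%R%:R)%:E))%E.
  move=> x0; rewrite integral_nneseries//; last 2 first.
    by move=> n; exact: measurable_layer.
    by move=> n s; exact: f0.
  by apply: eq_eseriesr => j _; rewrite ptail2_layer_cake.
(* The [a] side may be truncated at the same level, since this only lowers it. *)
apply: (@le_trans _ _ (c%:E * \sum_(0 <= j <oo)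
    (ptail2 (Order.min (a j) z))%:E)%E); last first.
  apply: lee_wpmul2l; first by rewrite lee_fin.
  apply: lee_nneseries => j _; rewrite lee_fin.
    by rewrite ptail2_ge0// le_min a0.
  by rewrite ptail2_nondecreasing ?le_min ?a0// ge_min lexx.
rewrite !swap// -ge0_integralZl//.
- apply: ge0_le_integral => //.
  + by move=> s zs; apply: nneseries_ge0 => n _ _; exact: f0.
  + apply: ge0_emeasurable_sum => [n s zs _|n _]; first exact: f0.
    exact: measurable_layer.
  + apply: emeasurable_funM => //; apply: ge0_emeasurable_sum => [n s zs _|n _].
      exact: f0.
    exact: measurable_layer.
  + move=> s /=; rewrite in_itv/= => /andP[s0 sz].
    rewrite !nneseriesZl; [|by move=> *; rewrite lee_fin..].
    (* The hypothesis excludes [s = 0], where the density vanishes anyway. *)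
    move: s0; rewrite le_eqVlt => /predU1P[<-|s0].
      by rewrite mul0r !mul0e mule0.
    rewrite muleCA; apply: lee_wpmul2l; last by apply: ab; rewrite s0.
    by rewrite lee_fin mulr_ge0 ?expR_ge0// ltW.
- apply: ge0_emeasurable_sum => [n s zs _|n _]; first exact: f0.
  exact: measurable_layer.
- by move=> s zs; apply: nneseries_ge0 => n _ _; exact: f0.
Qed.

End LayerCake.

(** * Elementary inequalities for powers and exponentials *)

Section Elementary.
Context {R : realType}.
Implicit Types a x alpha : R.

Lemma powR_gt1Dx a alpha : 0 < alpha -> 1 < a ->
  1 + alpha * (1 - a^-1) < a `^ alpha.
Proof.
move=> al a1; have a0 : 0 < a := lt_trans ltr01 a1.
have lna : 0 < ln a by rewrite ln_gt0.
apply: (@le_lt_trans _ _ (1 + alpha * ln a)).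
  rewrite lerD2l ler_wpM2l ?(ltW al)//.
  have := @le_ln1Dx R (a^-1 - 1); rewrite addrCA subrr addr0 lnV ?posrE//.
  by rewrite ltrBrDr addNr invr_gt0 a0 => /(_ isT); lra.
by rewrite /powR gt_eqF// expR_gt1Dx// mulf_neq0// gt_eqF.
Qed.

Lemma powR_inv_gt1Bx a alpha : 0 < alpha -> 1 < a ->
  1 - alpha * (a - 1) < a^-1 `^ alpha.
Proof.
move=> al a1; have a0 : 0 < a := lt_trans ltr01 a1.
have lna : 0 < ln a by rewrite ln_gt0.
apply: (@le_lt_trans _ _ (1 + alpha * ln a^-1)).
  rewrite lnV ?posrE// mulrN lerD2l lerN2 ler_wpM2l ?(ltW al)//.
  have := @le_ln1Dx R (a - 1); rewrite addrCA subrr addr0.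
  by rewrite ltrBrDr addNr a0 => /(_ isT).
rewrite /powR gt_eqF ?invr_gt0// expR_gt1Dx// lnV ?posrE//.
by rewrite mulf_neq0 ?oppr_eq0// gt_eqF.
Qed.

Lemma sqr_mul_expRN_le x : 0 <= x -> x ^+ 2 * expR (- x) <= 2.
Proof.
move=> x0; rewrite expRN ler_pdivrMr ?expR_gt0//.
by have := @expR_ge1Dxn R x 1 x0; rewrite (_ : 2`!%:R = 2 :> R)//; nra.
Qed.

(** Squares [expR (- 2^-1) >= 2^-1]. This crude value is where the factor 4, and with it the 32 and
    the 16 of later bounds, comes from. *)
Lemma expR1_le4 : expR 1 <= 4 :> R.
Proof.
have e2 : 2^-1 <= expR (- 2^-1) :> R.
  by apply: le_trans (expR_ge1Dx _); lra.
have -> : (1 : R) = 2^-1 + 2^-1 by lra.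
rewrite expRD; rewrite expRN in e2.
have e0 := expR_gt0 (2^-1 : R).
have : expR 2^-1 <= 2 :> R by rewrite -lef_pV2 ?posrE.
by nra.
Qed.

(** Follows from [(1 + x) * (1 - x + x ^+ 2) = 1 + x ^+ 3] and [expR x >= 1 + x]. *)
Lemma expRN_le x : 0 <= x -> expR (- x) <= 1 - x + x ^+ 2.
Proof.
move=> x0; rewrite expRN -[X in X <= _]div1r ler_pdivrMr ?expR_gt0//.
have := expR_ge1Dx x; set e := expR x => e1.
have h : 0 < 1 - x + x ^+ 2 by nra.
apply: le_trans (ler_wpM2l (ltW h) e1).
have x3 : 0 <= x ^+ 3 by rewrite exprn_ge0.
by nra.
Qed.

Lemma expRN_natmul n x : expR (- (n%:R * x)) = expR (- x) ^+ n.
Proof. by rewrite -mulrN expRM_natl. Qed.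

Lemma onem_exp_le n x : x <= 1 -> (1 - x) ^+ n <= expR (- (n%:R * x)).
Proof.
by move=> x1; rewrite expRN_natmul lerXn2r ?nnegrE ?subr_ge0 ?expR_ge0// expR_ge1Dx.
Qed.

(** The mean value bound [n a^(n-1) (a - b)] for [a^n - b^n], multiplied by [a] so that no
    predecessor exponent appears. *)
Lemma exprnB_le (a b : R) n : 0 <= b -> b <= a ->
  a * (a ^+ n - b ^+ n) <= n%:R * a ^+ n * (a - b).
Proof.
move=> b0 ba; have a0 : 0 <= a := le_trans b0 ba.
elim: n => [|n IH]; first by rewrite !expr0 subrr mulr0 !mul0r.
have -> : a * (a ^+ n.+1 - b ^+ n.+1) =
    a * (a * (a ^+ n - b ^+ n)) + a * (a - b) * b ^+ n by rewrite !exprS; ring.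
have -> : n.+1%:R * a ^+ n.+1 * (a - b) =
    a * (n%:R * a ^+ n * (a - b)) + a * (a - b) * a ^+ n.
  by rewrite !exprS -natr1; ring.
rewrite lerD ?ler_wpM2l// ?mulr_ge0 ?subr_ge0//.
by rewrite lerXn2r ?nnegrE.
Qed.

(** The gap between [expR (- (n x))] and [(1 - x) ^+ n] is of order [n x^2 expR (- (n x))]. Half of
    the exponent absorbs the extra square, leaving a factor of order [1 / n] and the summand of [G]
    at [n / 2], which regular variation keeps comparable to [G n]. *)
Lemma onem_exp_deficit n x : (0 < n)%N -> 0 <= x -> x <= 1 ->
  x ^+ 2 * expR (- (n%:R * x)) - x ^+ 2 * (1 - x) ^+ n <=
  32 / n%:R * (x ^+ 2 * expR (- (n%:R / 2 * x))).
Proof.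
move=> n0 x0 x1; have nR : 0 < n%:R :> R by rewrite ltr0n.
rewrite -mulrBr [leRHS]mulrCA ler_wpM2l ?sqr_ge0//.
have aE : expR (- (n%:R * x)) = expR (- (n%:R / 2 * x)) ^+ 2.
  by rewrite -expRM_natl; congr expR; field.
have := @exprnB_le (expR (- x)) (1 - x) n; rewrite -expRN_natmul subr_ge0.
rewrite expR_ge1Dx => /(_ x1 isT) H.
set A := expR (- (n%:R * x)) in H *; set B := (1 - x) ^+ n in H *.
have AB : A - B <= 4 * (n%:R * A * x ^+ 2).
  have h1 : expR (- x) * (A - B) <= n%:R * A * x ^+ 2.
    apply: le_trans H _; rewrite ler_wpM2l ?mulr_ge0 ?expR_ge0//.
    by have := expRN_le _ x0; lra.
  have AB0 : 0 <= A - B by rewrite subr_ge0 onem_exp_le.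
  have h2 : 4^-1 <= expR (- x).
    rewrite expRN lef_pV2 ?posrE ?expR_gt0//.
    by rewrite (le_trans _ expR1_le4)// ler_expR.
  rewrite -ler_pdivrMl//; apply: le_trans h1; exact: ler_wpM2r.
(* With [y = n x / 2] one has [4 n x^2 = (16 / n) y^2]; the bound [y^2 expR (- y) <= 2] then gives
   32. *)
apply: le_trans AB _; rewrite /A aE.
set y := n%:R / 2 * x; have y0 : 0 <= y by rewrite mulr_ge0// divr_ge0.
have -> : 4 * (n%:R * expR (- y) ^+ 2 * x ^+ 2) =
    16 / n%:R * expR (- y) * (y ^+ 2 * expR (- y)).
  by rewrite /y; field; rewrite gt_eqF.
have -> : 32 / n%:R * expR (- y) = 16 / n%:R * expR (- y) * 2.
  by field; rewrite gt_eqF.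
by rewrite ler_wpM2l ?sqr_mul_expRN_le ?mulr_ge0 ?expR_ge0// invr_ge0 ltW.
Qed.

Lemma onem_exp_pred_le n x : (0 < n)%N -> 0 <= x -> x <= 1 ->
  (1 - x) ^+ n.-1 <= 4 * expR (- (n%:R * x)).
Proof.
case: n => // n _ x0 x1; apply: le_trans (onem_exp_le _ _ x1) _ => /=.
have -> : n.+1%:R * x = x + n%:R * x by rewrite -natr1; ring.
rewrite opprD expRD mulrA ler_peMl ?expR_ge0// expRN ler_pdivlMr ?expR_gt0//.
by rewrite mul1r (le_trans _ expR1_le4)// ler_expR.
Qed.

End Elementary.

(** * Regular variation as convergence of ratios *)

Section RegularVariation.
Context {R : realType}.

Lemma near_pinfty_scale (a : R) (S : R -> Prop) : 0 < a ->
  (\forall x \near +oo, S x) -> \forall x \near +oo, S (a * x).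
Proof.
move=> a0 [M [_ MS]]; exists (M / a); split; first exact: num_real.
by move=> x Mx; apply: MS; rewrite mulrC -ltr_pdivrMr.
Qed.

Lemma cvg_pinfty_scale (a : R) (f : R -> R) (F : set_system R) : 0 < a ->
  f x @[x --> +oo] --> F -> f (a * x) @[x --> +oo] --> F.
Proof. by move=> a0 fF A /fF; exact: near_pinfty_scale. Qed.

Lemma regularly_varying_ratio (f ell : R -> R) (alpha a : R) :
  slowly_varying ell -> f x / (x `^ alpha * ell x) @[x --> +oo] --> (1 : R) ->
  0 < a -> f (a * x) / f x @[x --> +oo] --> a `^ alpha.
Proof.
move=> sv fl a0.
have ratio1 := cvg_pinfty_scale _ _ _ a0 fl.
have inv1 : (f x / (x `^ alpha * ell x))^-1 @[x --> +oo] --> (1 : R).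
  by rewrite -[X in _ --> X]invr1; apply: cvgV => //; exact: oner_neq0.
have : a `^ alpha * (f (a * x) / ((a * x) `^ alpha * ell (a * x)) *
    (f x / (x `^ alpha * ell x))^-1 * (ell (x * a) / ell x)) @[x --> +oo] -->
    a `^ alpha * (1 * 1 * 1).
  apply: cvgM; first exact: cvg_cst.
  by apply: cvgM; [exact: cvgM|exact: sv].
rewrite !mulr1.
have neq0 (h : R -> R) : h x @[x --> +oo] --> (1 : R) ->
    \forall x \near +oo, h x != 0.
  by move=> /cvgr_neq0; apply; exact: oner_neq0.
apply: cvg_trans; apply: near_eq_cvg; near=> x.
have x0 : 0 < x by near: x; exact: nbhs_pinfty_gt.
(* A quotient tending to 1 is eventually nonzero, which excludes the vanishing denominators that
   [x / 0 = 0] would hide. *)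
have : f x / (x `^ alpha * ell x) != 0 by near: x; exact: neq0.
have : f (a * x) / ((a * x) `^ alpha * ell (a * x)) != 0 by near: x; exact: neq0.
rewrite !mulf_eq0 !negb_or !invr_eq0 !mulf_eq0 !negb_or.
move=> /and3P[fax _ lax] /and3P[fx px lx].
have pa : a `^ alpha != 0 by rewrite gt_eqF// powR_gt0.
rewrite powRM ?ltW// [x * a]mulrC; field.
by rewrite fx px lx lax pa.
Unshelve. all: by end_near. Qed.

End RegularVariation.

(** * Asymptotics of the expected occupancy sums *)

Section Asymptotics.
Context {R : realType}.
Variables (q : nat -> R) (cnt : R -> R) (alpha : R).
Hypotheses (q0 : forall j, 0 <= q j) (q1 : series q @ \oo --> (1 : R)).
Hypothesis cntE : forall y, 0 < y ->
  (\sum_(0 <= j <oo) ((y <= q j)%R%:R)%:E = (cnt y)%:E)%E.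
Hypothesis alpha_gt0 : 0 < alpha.
Hypothesis cnt_rv : forall a, 0 < a ->
  cnt (1 / (a * x)) / cnt (1 / x) @[x --> +oo] --> a `^ alpha.

(** This is the [H] of the overview, and [sq_sum] is its [G]. *)
Definition ge2_sum (t : R) : R := rsum (fun j => ptail2 (t * q j)).
Definition sq_sum (t : R) : R := rsum (fun j => q j ^+ 2 * expR (- (t * q j))).

Lemma dominated_ptail2 t : 0 <= t -> dominated q (fun j => ptail2 (t * q j)).
Proof.
move=> t0; exists t => j; rewrite ger0_norm ?ptail2_le_id ?mulr_ge0//.
by rewrite ptail2_ge0// mulr_ge0.
Qed.

Lemma dominated_sq_exp t : 0 <= t ->
  dominated q (fun j => q j ^+ 2 * expR (- (t * q j))).
Proof.
move=> t0; exists 1 => j; rewrite mul1r ger0_norm ?mulr_ge0 ?expR_ge0 ?sqr_ge0//.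
rewrite expr2 -mulrA ler_piMr// mulr_ile1 ?expR_ge0 ?(pmf_le1 q)//.
by rewrite expR_le1 oppr_le0 mulr_ge0.
Qed.

Lemma cnt_ge0 y : 0 < y -> 0 <= cnt y.
Proof.
move=> y0; rewrite -lee_fin -cntE//.
by apply: nneseries_ge0 => n _ _; rewrite lee_fin.
Qed.

Lemma cnt_nonincreasing x y : 0 < x -> x <= y -> cnt y <= cnt x.
Proof.
move=> x0 xy; rewrite -lee_fin -!cntE ?(lt_le_trans x0)//.
apply: lee_nneseries => n _; first by rewrite lee_fin.
rewrite lee_fin ler_nat; case: (leP y (q n)) => // yq.
by rewrite (le_trans xy yq).
Qed.

Lemma ge2_sum_ge_cnt t : 0 < t -> ptail2 1 * cnt (1 / t) <= ge2_sum t.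
Proof.
move=> t0; rewrite -lee_fin EFinM -cntE ?divr_gt0// -nneseriesZl; last first.
  by move=> *; rewrite lee_fin.
have tq j : 0 <= t * q j by rewrite mulr_ge0// ltW.
rewrite -(nneseries_rsum q)//; [|exact/dominated_ptail2/ltW|
  by move=> j; rewrite ptail2_ge0].
apply: lee_nneseries => j _.
  by rewrite -EFinM lee_fin mulr_ge0// ptail2_ge0.
rewrite -EFinM lee_fin; case: (leP (1 / t) (q j)) => [|_]; last first.
  by rewrite mulr0 ptail2_ge0.
by rewrite ler_pdivrMr// mulrC => ?; rewrite mulr1 ptail2_nondecreasing.
Qed.

Lemma ge2_sum_comparison (a c x0 : R) : 0 < a -> 0 <= c -> 0 < x0 ->
  (forall x, x0 <= x -> cnt (1 / (a * x)) <= c * cnt (1 / x)) ->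
  forall t, 0 < t -> ge2_sum (a * t) <= c * ge2_sum t + cnt (1 / (a * x0)).
Proof.
move=> a0 c0 x00 ac t t0.
have tq j : 0 <= t * q j by rewrite mulr_ge0// ltW.
have atq j : 0 <= a * t * q j by rewrite -mulrA mulr_ge0// ltW.
have z0 : 0 <= t / x0 by rewrite ltW// divr_gt0.
rewrite -lee_fin EFinD EFinM -cntE ?divr_gt0 ?mulr_gt0//.
rewrite -!(nneseries_rsum q)//; [|exact/dominated_ptail2/ltW|
  by move=> j; rewrite ptail2_ge0|by apply/dominated_ptail2/ltW; rewrite mulr_gt0|
  by move=> j; rewrite ptail2_ge0].
(* With [z = t / x0], [ptail2 u] is at most [ptail2 (min u z)] plus the indicator of [u > z]. For
   [u = a * t * q j] this event implies [q j >= 1 / (a * x0)], so the number of exceptional cells is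
   bounded independently of [t]. *)
apply: (@le_trans _ _
  (\sum_(0 <= j <oo) (ptail2 (Order.min (a * t * q j) (t / x0)))%:E +
   \sum_(0 <= j <oo) ((1 / (a * x0) <= q j)%R%:R)%:E)%E).
  rewrite -nneseriesD//; last first.
    by move=> i _ _; rewrite lee_fin ptail2_ge0// le_min atq.
  apply: lee_nneseries => j _; first by rewrite lee_fin ptail2_ge0.
  rewrite -EFinD lee_fin; case: (leP (a * t * q j) (t / x0)) => [_|].
    by rewrite lerDl.
  move=> /ltW tz; rewrite (_ : 1 / (a * x0) <= q j); last first.
    rewrite ler_pdivrMr ?mulr_gt0//; move: tz; rewrite ler_pdivrMr//.
    have -> : a * t * q j * x0 = t * (q j * (a * x0)) by ring.
    by rewrite -[X in X <= _]mulr1 ler_pM2l.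
  by rewrite (le_trans (ptail2_le1 _ (atq j)))// lerDr ptail2_ge0.
apply: leeD2r; apply: ptail2_comparison => // s /andP[s0 sz].
(* The condition [s <= b * q j] counts cells at level [1 / (b / s)]; hence [x = t / s], and
   [s <= t / x0] is [x0 <= x]. *)
have rescale b : 0 < b ->
    (\sum_(0 <= j <oo) ((s <= b * q j)%R%:R)%:E = (cnt (1 / (b / s)))%:E)%E.
  move=> b0; rewrite -cntE ?divr_gt0//; apply: eq_eseriesr => j _.
  by rewrite div1r invf_div ler_pdivrMr// mulrC.
rewrite !rescale ?mulr_gt0// -EFinM lee_fin -mulrA ac//.
by rewrite ler_pdivlMr// mulrC -ler_pdivlMr.
Qed.

Lemma cnt_cvgy (A : R) : \forall x \near +oo, A <= cnt (1 / x).
Proof.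
(* At [a = 1] the quotient of the count by itself tends to 1, which [0 / 0 = 0] forbids for a
   vanishing count. *)
have pos : \forall x \near +oo, 0 < cnt (1 / x).
  have /cvgr_neq0 : cnt (1 / (1 * x)) / cnt (1 / x) @[x --> +oo] --> (1 : R).
    by have := cnt_rv _ ltr01; rewrite powR1.
  move=> /(_ (oner_neq0 _)) nz; near=> x.
  rewrite lt_neqAle cnt_ge0 ?andbT ?divr_gt0//.
  have : cnt (1 / (1 * x)) / cnt (1 / x) != 0 by near: x; exact: nz.
  by rewrite mulf_eq0 negb_or !mul1r => /andP[+ _]; rewrite eq_sym.
have [c /andP[c1 c2]] : exists c : R, 1 < c < 2 `^ alpha.
  have two : (1 : R) < 2 `^ alpha.
    by rewrite /powR pnatr_eq0/= expR_gt1 mulr_gt0// ln_gt0// ltr1n.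
  by exists ((1 + 2 `^ alpha) / 2); apply/andP; split; lra.
have grow : \forall x \near +oo, c * cnt (1 / x) <= cnt (1 / (2 * x)).
  have /cvgr_ge : cnt (1 / (2 * x)) / cnt (1 / x) @[x --> +oo] --> 2 `^ alpha.
    exact: cnt_rv.
  move=> /(_ _ c2) ge_c; near=> x.
  rewrite -ler_pdivlMr; last by near: x.
  by near: x.
have [x0 [x00 x0pos x0grow]] : exists x0, [/\ 0 < x0, 0 < cnt (1 / x0) &
    forall x, x0 <= x -> c * cnt (1 / x) <= cnt (1 / (2 * x))].
  have [M1 [_ M1P]] := pos; have [M2 [_ M2P]] := grow.
  exists (Num.max 1 (Num.max (M1 + 1) (M2 + 1))); split.
  - by rewrite lt_max ltr01.
  - by apply: M1P; rewrite !lt_max ltrDl ltr01 orbT.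
  - by move=> x; rewrite !ge_max => /and3P[_ _ Mx]; apply: M2P;
      rewrite (lt_le_trans _ Mx)// ltrDl.
(* The linear Bernoulli lower bound for [c ^+ k] suffices for divergence and allows an explicit
   [k]. *)
have iter k : (1 + k%:R * (c - 1)) * cnt (1 / x0) <= cnt (1 / (2 ^+ k * x0)).
  elim: k => [|k IH]; first by rewrite mul0r addr0 !mul1r.
  have px : x0 <= 2 ^+ k * x0 by rewrite ler_peMl ?exprn_ege1 ?ler1n ?(ltW x00).
  rewrite exprS -mulrA (le_trans _ (x0grow _ px))//.
  apply: le_trans (ler_wpM2l _ IH); last by lra.
  rewrite mulrA ler_wpM2r ?(ltW x0pos)// -natr1.
  have -> : c * (1 + k%:R * (c - 1)) =
    1 + (k%:R + 1) * (c - 1) + k%:R * (c - 1) ^+ 2 by ring.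
  by rewrite lerDl mulr_ge0// sqr_ge0.
pose k := Num.truncn (A / ((c - 1) * cnt (1 / x0))).
have Ak : A <= cnt (1 / (2 ^+ k.+1 * x0)).
  apply: le_trans (iter k.+1).
  have := truncnS_gt (A / ((c - 1) * cnt (1 / x0))).
  rewrite ltr_pdivrMr ?mulr_gt0 ?subr_gt0// => /ltW/le_trans; apply.
  by rewrite mulrA ler_wpM2r ?(ltW x0pos)// lerDr.
have x2 : 0 < 2 ^+ k.+1 * x0 by rewrite mulr_gt0// exprn_gt0.
near=> x.
have xk : 2 ^+ k.+1 * x0 <= x by near: x; apply: nbhs_pinfty_ge; rewrite num_real.
have xpos : 0 < x := lt_le_trans x2 xk.
apply: le_trans Ak _; apply: cnt_nonincreasing; first by rewrite divr_gt0.
by rewrite !div1r lef_pV2 ?posrE.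
Unshelve. all: by end_near. Qed.

Lemma ge2_sum_cvgy (A : R) : \forall t \near +oo, A <= ge2_sum t.
Proof.
have p1 : 0 < ptail2 1 :> R by rewrite ptail2_gt0.
near=> t; apply: le_trans (ge2_sum_ge_cnt _ _) => //.
by rewrite mulrC -ler_pdivrMr//; near: t; exact: cnt_cvgy.
Unshelve. all: by end_near. Qed.

(** An intermediate constant [b] bounds the counts; the slack [c - b] times the divergent
    [ge2_sum t] absorbs the additive constant of the comparison. *)
Lemma ge2_sum_scale_le (a c : R) : 0 < a -> a `^ alpha < c ->
  \forall t \near +oo, ge2_sum (a * t) <= c * ge2_sum t.
Proof.
move=> a0 ac; pose b := (a `^ alpha + c) / 2.
have ab : a `^ alpha < b by rewrite midf_lt.
have bc : b < c by rewrite midf_lt.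
have [M [_ MP]] : \forall x \near +oo, cnt (1 / (a * x)) <= b * cnt (1 / x).
  have /cvgr_le := cnt_rv _ a0; move=> /(_ _ ab) le_b; near=> x.
  rewrite -ler_pdivrMr; first by near: x.
  by rewrite (lt_le_trans ltr01)//; near: x; exact: cnt_cvgy.
pose x0 := Num.max 1 (M + 1).
have x00 : 0 < x0 by rewrite lt_max ltr01.
have b0 : 0 <= b by rewrite (le_trans _ (ltW ab))// powR_ge0.
have cmp x : x0 <= x -> cnt (1 / (a * x)) <= b * cnt (1 / x).
  rewrite ge_max => /andP[_ Mx]; apply: MP.
  by rewrite (lt_le_trans _ Mx)// ltrDl.
near=> t.
have t0 : 0 < t by near: t; apply: nbhs_pinfty_gt; rewrite num_real.
apply: le_trans (ge2_sum_comparison _ _ _ a0 b0 x00 cmp t t0) _.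
rewrite -lerBrDl -mulrBl -ler_pdivrMl ?subr_gt0//.
by near: t; exact: ge2_sum_cvgy.
Unshelve. all: by end_near. Qed.

(** For [c > 0] this is the upper bound for the scale [a^-1] and constant [c^-1], read at the
    argument [a * t]. *)
Lemma ge2_sum_scale_ge (a c : R) : 0 < a -> c < a `^ alpha ->
  \forall t \near +oo, c * ge2_sum t <= ge2_sum (a * t).
Proof.
move=> a0 ac; have [c0|c0] := leP c 0.
  near=> t; apply: (@le_trans _ _ 0).
    by rewrite mulr_le0_ge0//; near: t; exact: ge2_sum_cvgy.
  by near: t; apply: (near_pinfty_scale _ (fun t => 0 <= ge2_sum t));
    [|exact: ge2_sum_cvgy].
have : \forall t \near +oo, ge2_sum (a^-1 * t) <= c^-1 * ge2_sum t.
  apply: ge2_sum_scale_le; first by rewrite invr_gt0.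
  by rewrite -powR_inv1 ?ltW// -powRrM mulN1r powRN ltf_pV2 ?posrE ?powR_gt0.
move=> /(near_pinfty_scale _ _ a0); apply: filterS => t.
by rewrite mulKf ?gt_eqF// mulrC ler_pdivlMr// mulrC.
Unshelve. all: by end_near. Qed.


Lemma ge2_sum_scale_cvg (a : R) : 0 < a ->
  ge2_sum (a * t) / ge2_sum t @[t --> +oo] --> a `^ alpha.
Proof.
move=> a0; apply/cvgrPdist_le => e e0.
have lo : a `^ alpha - e < a `^ alpha by rewrite ltrBlDr ltrDl.
have up : a `^ alpha < a `^ alpha + e by rewrite ltrDl.
have := ge2_sum_scale_ge _ _ a0 lo; have := ge2_sum_scale_le _ _ a0 up => hu hl.
near=> t; have Ht : 0 < ge2_sum t.
  by rewrite (lt_le_trans ltr01)//; near: t; exact: ge2_sum_cvgy.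
rewrite distrC ler_distl; apply/andP; split.
  by rewrite ler_pdivlMr//; near: t.
by rewrite ler_pdivrMr//; near: t.
Unshelve. all: by end_near. Qed.

Lemma ge2_sum_diff_le (a t : R) : 1 <= a -> 0 <= t ->
  ge2_sum (a * t) - ge2_sum t <= (a ^+ 2 - 1) / 2 * (t ^+ 2 * sq_sum t).
Proof.
move=> a1 t0; have a0 : 0 <= a := le_trans ler01 a1.
rewrite /ge2_sum /sq_sum mulrA -(rsumB q)//; [|
  by apply: dominated_ptail2; rewrite mulr_ge0|exact: dominated_ptail2].
rewrite -(rsumZ q)//; last exact: dominated_sq_exp.
apply: (rsum_le q) => //.
- by apply: dominatedB; apply: dominated_ptail2; rewrite ?mulr_ge0.
- exact/dominatedZ/dominated_sq_exp.
- move=> j; rewrite -!mulrA.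
  apply: le_trans (ptail2_scale_le _ _ (mulr_ge0 t0 (q0 j)) a1) _.
  by rewrite exprMn !mulrA.
Qed.

Lemma ge2_sum_diff_ge (a t : R) : 1 <= a -> 0 <= t ->
  (a ^+ 2 - 1) / 2 * (t ^+ 2 * sq_sum (a * t)) <= ge2_sum (a * t) - ge2_sum t.
Proof.
move=> a1 t0; have a0 : 0 <= a := le_trans ler01 a1.
rewrite /ge2_sum /sq_sum mulrA -(rsumB q)//; [|
  by apply: dominated_ptail2; rewrite mulr_ge0|exact: dominated_ptail2].
rewrite -(rsumZ q)//; last by apply: dominated_sq_exp; rewrite mulr_ge0.
apply: (rsum_le q) => //.
- by apply/dominatedZ/dominated_sq_exp; rewrite mulr_ge0.
- by apply: dominatedB; apply: dominated_ptail2; rewrite ?mulr_ge0.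
- move=> j; rewrite -!mulrA.
  apply: le_trans (ptail2_scale_ge _ _ (mulr_ge0 t0 (q0 j)) a1).
  by rewrite exprMn !mulrA.
Qed.

(** The increment of [H] from [t] to [a * t] is at most [(a^2 - 1) / 2] times [t^2 G t] and
    eventually at least [alpha (1 - 1/a) H t]: this is the lower bound. The increment from [t / a]
    to [t] gives the upper one. Both tend to [alpha] as [a] tends to 1. *)
Lemma sq_sum_ratio_bounds (a : R) : 1 < a -> \forall t \near +oo,
  2 * alpha / (a * (a + 1)) <= t ^+ 2 * sq_sum t / ge2_sum t <=
  2 * alpha * a ^+ 2 / (a + 1).
Proof.
move=> a1; have a0 : 0 < a := lt_trans ltr01 a1.
have lo := ge2_sum_scale_ge _ _ a0 (powR_gt1Dx _ _ alpha_gt0 a1).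
have ai0 : 0 < a^-1 by rewrite invr_gt0.
have up := ge2_sum_scale_ge _ _ ai0 (powR_inv_gt1Bx _ _ alpha_gt0 a1).
near=> t.
have t0 : 0 < t by near: t; apply: nbhs_pinfty_gt; rewrite num_real.
have Ht : 0 < ge2_sum t.
  by rewrite (lt_le_trans ltr01)//; near: t; exact: ge2_sum_cvgy.
have : (1 + alpha * (1 - a^-1)) * ge2_sum t <= ge2_sum (a * t) by near: t.
have : (1 - alpha * (a - 1)) * ge2_sum t <= ge2_sum (a^-1 * t) by near: t.
have := ge2_sum_diff_le _ _ (ltW a1) (ltW t0).
have := ge2_sum_diff_ge _ (a^-1 * t) (ltW a1) (mulr_ge0 (ltW ai0) (ltW t0)).
rewrite mulVKf ?gt_eqF// => h1 h2 h3 h4.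
have a21 : 0 < (a ^+ 2 - 1) / 2 by rewrite divr_gt0// subr_gt0 exprn_egt1.
rewrite ler_pdivlMr// ler_pdivrMr//; apply/andP; split.
- rewrite -(ler_pM2l a21); apply: le_trans h2.
  apply: (@le_trans _ _ (alpha * (1 - a^-1) * ge2_sum t)); last by lra.
  rewrite le_eqVlt; apply/orP; left; apply/eqP; field.
  by rewrite !gt_eqF// addr_gt0.
- have b0 : 0 < (a ^+ 2 - 1) / 2 * a^-1 ^+ 2 by rewrite mulr_gt0// exprn_gt0.
  rewrite -(ler_pM2l b0).
  have -> : (a ^+ 2 - 1) / 2 * a^-1 ^+ 2 * (t ^+ 2 * sq_sum t) =
     (a ^+ 2 - 1) / 2 * ((a^-1 * t) ^+ 2 * sq_sum t) by ring.
  apply: le_trans h1 _.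
  apply: (@le_trans _ _ (alpha * (a - 1) * ge2_sum t)); first by lra.
  rewrite le_eqVlt; apply/orP; left; apply/eqP; field.
  by rewrite !gt_eqF// addr_gt0.
Unshelve. all: by end_near. Qed.

Lemma sq_sum_ratio_cvg :
  t ^+ 2 * sq_sum t / ge2_sum t @[t --> +oo] --> alpha.
Proof.
apply/cvgrPdist_le => e e0.
(* Chosen so that [b < 1] and [6 * alpha * b <= e]; at [a = 1 + b] both bounds lie within
   [6 * alpha * b] of [alpha]. *)
pose b := e / (e + 6 * alpha); pose a := 1 + b.
have b0 : 0 < b by rewrite divr_gt0// addr_gt0// mulr_gt0.
have b1 : b < 1 by rewrite ltr_pdivrMr ?mul1r ?ltrDl ?addr_gt0 ?mulr_gt0.
have be : 6 * alpha * b <= e.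
  rewrite /b mulrCA -[X in _ <= X]mulr1 ler_wpM2l ?(ltW e0)//.
  by rewrite ler_pdivrMr ?addr_gt0 ?mulr_gt0// mul1r lerDr ltW.
have a1 : 1 < a by rewrite ltrDl.
near=> t.
have /andP[lo up] : 2 * alpha / (a * (a + 1)) <=
    t ^+ 2 * sq_sum t / ge2_sum t <= 2 * alpha * a ^+ 2 / (a + 1).
  by near: t; exact: sq_sum_ratio_bounds.
rewrite distrC ler_distl; apply/andP; split.
- apply: le_trans lo; rewrite ler_pdivlMr ?mulr_gt0 ?addr_gt0//.
  have al := alpha_gt0; rewrite /a; nra.
- apply: le_trans up _; rewrite ler_pdivrMr ?addr_gt0//.
  have al := alpha_gt0; rewrite /a; nra.
Unshelve. all: by end_near. Qed.

Lemma sq_sum_near_gt0 : \forall t \near +oo, 0 < sq_sum t.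
Proof.
have /cvgr_gt /(_ _ alpha_gt0) gt0 := sq_sum_ratio_cvg; near=> t.
have t0 : 0 < t by near: t; apply: nbhs_pinfty_gt; rewrite num_real.
have Ht : 0 < ge2_sum t.
  by rewrite (lt_le_trans ltr01)//; near: t; exact: ge2_sum_cvgy.
have : 0 < t ^+ 2 * sq_sum t / ge2_sum t by near: t.
by rewrite pmulr_lgt0 ?invr_gt0// pmulr_rgt0// exprn_gt0.
Unshelve. all: by end_near. Qed.

(** [G t] is [t^-2 * H t] times a factor tending to [alpha > 0], so it inherits the index of [H]
    lowered by 2. *)
Lemma sq_sum_scale_cvg (a : R) : 0 < a ->
  sq_sum (a * t) / sq_sum t @[t --> +oo] --> a `^ (alpha - 2).
Proof.
move=> a0.
have -> : a `^ (alpha - 2) = a ^- 2 * (alpha * alpha^-1 * a `^ alpha).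
  rewrite divff ?gt_eqF// mul1r mulrC powRD; last by rewrite (gt_eqF a0) implybT.
  by rewrite powR_invn ?ltW.
have : a ^- 2 * ((a * t) ^+ 2 * sq_sum (a * t) / ge2_sum (a * t) *
    (t ^+ 2 * sq_sum t / ge2_sum t)^-1 * (ge2_sum (a * t) / ge2_sum t))
    @[t --> +oo] --> a ^- 2 * (alpha * alpha^-1 * a `^ alpha).
  apply: cvgM; first exact: cvg_cst.
  apply: cvgM; last exact: ge2_sum_scale_cvg.
  apply: cvgM; last by apply: cvgV; [rewrite gt_eqF|exact: sq_sum_ratio_cvg].
  exact: (cvg_pinfty_scale _ _ _ a0 sq_sum_ratio_cvg).
apply: cvg_trans; apply: near_eq_cvg; near=> t.
have t0 : 0 < t by near: t; apply: nbhs_pinfty_gt; rewrite num_real.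
have Ht : 0 < ge2_sum t.
  by rewrite (lt_le_trans ltr01)//; near: t; exact: ge2_sum_cvgy.
have Hat : 0 < ge2_sum (a * t).
  rewrite (lt_le_trans ltr01)//; near: t.
  by apply: (near_pinfty_scale _ (fun t => 1 <= ge2_sum t)) => //;
    exact: ge2_sum_cvgy.
have Gt : 0 < sq_sum t by near: t; exact: sq_sum_near_gt0.
by field; rewrite !gt_eqF.
Unshelve. all: by end_near. Qed.

Lemma nat_cvg_pinfty (f : R -> R) (F : set_system R) :
  f x @[x --> +oo] --> F -> f n%:R @[n --> \oo] --> F.
Proof. by move=> fF; apply: cvg_comp fF; exact: cvgr_idn. Qed.

Lemma near_nat_pinfty (S : R -> Prop) :
  (\forall x \near +oo, S x) -> \forall n \near \oo, S n%:R.
Proof. by move=> xS; exact: (cvgr_idn xS). Qed.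

Lemma dominated_sq_onem n : dominated q (fun j => q j ^+ 2 * (1 - q j) ^+ n).
Proof.
apply: dominated_le (dominated_sq_exp 0 (lexx _)) _ => j.
rewrite mul0r oppr0 expR0 mulr1 normrM ler_piMr// normrX exprn_ile1//.
by rewrite ger0_norm ?subr_ge0 ?lerBlDr ?lerDl ?(pmf_le1 q).
Qed.

(** The deficit is at most [(32 / n) * G (n / 2)], and [G (n / 2) / G n] stays below any [K]
    exceeding its limit. *)
Lemma sq_sum_onem_cvg :
  rsum (fun j => q j ^+ 2 * (1 - q j) ^+ n) / sq_sum n%:R @[n --> \oo] --> (1 : R).
Proof.
have dB := dominated_sq_onem.
apply/cvgrPdist_le => e e0.
have half := nat_cvg_pinfty _ _ (sq_sum_scale_cvg 2^-1 _).
have h2 : 0 < 2^-1 :> R by rewrite invr_gt0.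
pose K := (2^-1 : R) `^ (alpha - 2) + 1.
have K0 : 0 < K by rewrite addr_gt0// powR_gt0.
have hK : \forall n \near \oo, sq_sum (2^-1 * n%:R) / sq_sum n%:R <= K.
  by apply: (cvgr_le _ (half h2)); rewrite ltrDl.
near=> n.
have n0 : (0 < n)%N by near: n; exact: nbhs_infty_gt.
have nR : 0 < n%:R :> R by rewrite ltr0n.
have G0 : 0 < sq_sum n%:R.
  by near: n; exact: near_nat_pinfty sq_sum_near_gt0.
rewrite -[X in X - _](divff (lt0r_neq0 G0)) -mulrBl ger0_norm; last first.
  rewrite divr_ge0 ?(ltW G0)// subr_ge0; apply: (rsum_le q) => //.
    exact/dominated_sq_exp/ltW.
  by move=> j; rewrite ler_wpM2l ?sqr_ge0// onem_exp_le ?(pmf_le1 q).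
rewrite ler_pdivrMr// -(rsumB q)//; last exact/dominated_sq_exp/ltW.
apply: (@le_trans _ _ (32 / n%:R * sq_sum (n%:R / 2))).
  rewrite -(rsumZ q)//; last by apply: dominated_sq_exp; rewrite divr_ge0.
  apply: (rsum_le q) => //.
  - by apply: dominatedB => //; exact/dominated_sq_exp/ltW.
  - by apply/dominatedZ/dominated_sq_exp; rewrite divr_ge0.
  - by move=> j; exact: onem_exp_deficit (q0 j) (pmf_le1 q q0 q1 j).
have : sq_sum (2^-1 * n%:R) / sq_sum n%:R <= K by near: n.
rewrite ler_pdivrMr// mulrC => GK.
apply: le_trans (ler_wpM2l _ GK) _; first by rewrite divr_ge0.
rewrite mulrA ler_wpM2r ?(ltW G0)// mulrAC ler_pdivrMr//.
rewrite -ler_pdivrMl//; near: n.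
exact: nbhs_infty_ger.
Unshelve. all: by end_near. Qed.

(** Dominated convergence by hand: the [j]-th term is at most [q j] and at most [2 / n], so a fixed
    tail of [q] controls all but [m] terms and those [m] terms vanish as [n] grows. It makes the
    total covariance negligible against [G n]. *)
Lemma sq_sum_linear_cvg0 : n%:R * sq_sum n%:R @[n --> \oo] --> (0 : R).
Proof.
apply/cvgrPdist_le => e e0.
have e2 : 0 < e / 2 by rewrite divr_gt0.
have [m _ mP] : \forall m \near \oo, 1 - series q m <= e / 2.
  move/cvgrPdist_le : q1 => /(_ _ e2); apply: filterS => m.
  by apply: le_trans; exact: ler_norm.
have {}mP := mP _ (leqnn m).
near=> n.
have n0 : (0 < n)%N by near: n; exact: nbhs_infty_gt.
have nR : 0 < n%:R :> R by rewrite ltr0n.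
have dG := dominated_sq_exp _ (ltW nR).
rewrite sub0r normrN ger0_norm; last first.
  rewrite mulr_ge0 ?(ltW nR)// (rsum_ge0 q)// => j.
  by rewrite mulr_ge0 ?sqr_ge0 ?expR_ge0.
pose a j := n%:R * (q j ^+ 2 * expR (- (n%:R * q j))).
have da : dominated q a by exact: dominatedZ.
have ale j : a j <= 2 / n%:R.
  rewrite ler_pdivlMr//; apply: le_trans (sqr_mul_expRN_le (n%:R * q j) _).
    by rewrite /a le_eqVlt; apply/orP; left; apply/eqP; ring.
  by rewrite mulr_ge0// ltW.
have aq j : a j <= q j.
  have -> : a j = q j * (n%:R * q j * expR (- (n%:R * q j))) by rewrite /a; ring.
  rewrite ler_piMr// expRN ler_pdivrMr ?expR_gt0// mul1r.
  by rewrite (le_trans _ (expR_ge1Dx _))// lerDr.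
have -> : n%:R * sq_sum n%:R = rsum a by rewrite /a (rsumZ q).
have tail : rsum a - series a m <= 1 - series q m.
  have dqa : dominated q (fun j => q j - a j).
    by apply: dominatedB => //; exact: dominated_self.
  have : series (fun j => q j - a j) m <= rsum (fun j => q j - a j).
    by apply: (le_rsum q) => // j; rewrite subr_ge0.
  rewrite (rsumB q)//; last exact: dominated_self.
  by rewrite (rsum_pmf q)// /series /= sumrB; lra.
have am : series a m <= m%:R * (2 / n%:R).
  rewrite /series /= -[m in m%:R]subn0 mulr_natl -sumr_const_nat.
  by apply: ler_sum => j _.
have mn : m%:R * (2 / n%:R) <= e / 2.
  rewrite mulrA ler_pdivrMr// -ler_pdivrMl//; near: n; exact: nbhs_infty_ger.
lra.
Unshelve. all: by end_near. Qed.

End Asymptotics.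

(** * Real expectations of bounded random variables *)

Section BoundedRandomVariables.
Context {d} {T : measurableType d} {R : realType} (P : probability T R).
Implicit Types (X Y : T -> R) (b : T -> bool).

Definition bounded_rv X : Prop :=
  measurable_fun setT X /\ exists M : R, forall w, `|X w| <= M.

Definition mean X : R := Rintegral P setT X.

Lemma bounded_rv_integrable X : bounded_rv X -> P.-integrable setT (EFin \o X).
Proof.
move=> [mX [M XM]]; apply: measurable_bounded_integrable => //.
  by rewrite -ge0_fin_numE//; exact: fin_num_measure.
exists M; split=> [|x Mx w _]; first exact: num_real.
exact: le_trans (XM w) (ltW Mx).
Qed.

Lemma expectation_mean X : bounded_rv X -> 'E_P[X]%E = (mean X)%:E.
Proof.
move=> bX; rewrite unlock /mean /Rintegral fineK//.
exact: integrable_fin_num (bounded_rv_integrable _ bX).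
Qed.

Lemma bounded_rv_cst (k : R) : bounded_rv (fun=> k).
Proof. by split; [exact: measurable_cst|exists `|k|]. Qed.

Lemma bounded_rvD X Y : bounded_rv X -> bounded_rv Y ->
  bounded_rv (fun w => X w + Y w).
Proof.
move=> [mX [M XM]] [mY [L YL]]; split; first exact: measurable_funD.
by exists (M + L) => w; rewrite (le_trans (ler_normD _ _))// lerD.
Qed.

Lemma bounded_rvM X Y : bounded_rv X -> bounded_rv Y ->
  bounded_rv (fun w => X w * Y w).
Proof.
move=> [mX [M XM]] [mY [L YL]]; split; first exact: measurable_funM.
by exists (M * L) => w; rewrite normrM ler_pM.
Qed.

Lemma bounded_rvZ (k : R) X : bounded_rv X -> bounded_rv (fun w => k * X w).
Proof. by move=> bX; apply: bounded_rvM => //; exact: bounded_rv_cst. Qed.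

Lemma bounded_rvB X Y : bounded_rv X -> bounded_rv Y ->
  bounded_rv (fun w => X w - Y w).
Proof.
move=> bX /(bounded_rvZ (-1)) bY.
by have := bounded_rvD _ _ bX bY; under eq_fun do rewrite mulN1r.
Qed.

Lemma bounded_rv_sum I (s : seq I) (Q : pred I) (F : I -> T -> R) :
  (forall i, bounded_rv (F i)) -> bounded_rv (fun w => \sum_(i <- s | Q i) F i w).
Proof.
move=> bF; elim: s => [|i s IH].
  by under eq_fun do rewrite big_nil; exact: bounded_rv_cst.
under eq_fun do rewrite big_cons.
by case: (Q i) => //; exact: bounded_rvD.
Qed.

Lemma bounded_rv_prod I (s : seq I) (Q : pred I) (F : I -> T -> R) :
  (forall i, bounded_rv (F i)) ->
  bounded_rv (fun w => \prod_(i <- s | Q i) F i w).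
Proof.
move=> bF; elim: s => [|i s IH].
  by under eq_fun do rewrite big_nil; exact: bounded_rv_cst.
under eq_fun do rewrite big_cons.
by case: (Q i) => //; exact: bounded_rvM.
Qed.

Lemma bounded_rv_expR X : bounded_rv X -> bounded_rv (fun w => expR (X w)).
Proof.
move=> [mX [M XM]]; split; first exact: measurableT_comp.
exists (expR M) => w; rewrite ger0_norm ?expR_ge0// ler_expR.
exact: le_trans (ler_norm _) (XM w).
Qed.

Lemma indicator_bool b : (fun w => (b w)%:R : R) = \1_[set w | b w].
Proof.
apply/funext => w; rewrite indicE; case bw: (b w); first by rewrite mem_set.
by rewrite memNset//= bw.
Qed.

Lemma bounded_rv_bool b : measurable [set w | b w] ->
  bounded_rv (fun w => (b w)%:R).
Proof.
move=> mb; split; first by rewrite indicator_bool; exact: measurable_indic.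
by exists 1 => w; rewrite ger0_norm// lern1 leq_b1.
Qed.

Lemma mean_bool b : measurable [set w | b w] ->
  (mean (fun w => (b w)%:R))%:E = P [set w | b w].
Proof.
move=> mb; rewrite -expectation_mean; last exact: bounded_rv_bool.
by rewrite indicator_bool expectation_indic.
Qed.

Lemma mean_cst (k : R) : mean (fun=> k) = k.
Proof.
apply: EFin_inj; rewrite -expectation_mean; first exact: expectation_cst.
exact: bounded_rv_cst.
Qed.

Lemma meanD X Y : bounded_rv X -> bounded_rv Y ->
  mean (fun w => X w + Y w) = mean X + mean Y.
Proof. by move=> bX bY; apply: RintegralD => //; exact: bounded_rv_integrable. Qed.

Lemma meanB X Y : bounded_rv X -> bounded_rv Y ->
  mean (fun w => X w - Y w) = mean X - mean Y.
Proof. by move=> bX bY; apply: RintegralB => //; exact: bounded_rv_integrable. Qed.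

Lemma meanZ (k : R) X : bounded_rv X -> mean (fun w => k * X w) = k * mean X.
Proof. by move=> bX; apply: RintegralZl => //; exact: bounded_rv_integrable. Qed.

Lemma mean_sum I (s : seq I) (Q : pred I) (F : I -> T -> R) :
  (forall i, bounded_rv (F i)) ->
  mean (fun w => \sum_(i <- s | Q i) F i w) = \sum_(i <- s | Q i) mean (F i).
Proof.
move=> bF; elim: s => [|i s IH].
  by rewrite big_nil; under eq_fun do rewrite big_nil; exact: mean_cst.
under eq_fun do rewrite big_cons; rewrite big_cons.
case: (Q i) => //; rewrite meanD ?IH//; exact: bounded_rv_sum.
Qed.

Lemma le_mean X Y : bounded_rv X -> bounded_rv Y -> (forall w, X w <= Y w) ->
  mean X <= mean Y.
Proof.
by move=> bX bY XY; apply: le_Rintegral => //; exact: bounded_rv_integrable.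
Qed.

Lemma mean_gt0 X : bounded_rv X -> (exists2 e : R, 0 < e & forall w, e <= X w) ->
  0 < mean X.
Proof.
move=> bX [e e0 eX]; apply: lt_le_trans e0 _.
by rewrite -[leLHS]mean_cst; apply: le_mean => //; exact: bounded_rv_cst.
Qed.

Lemma bounded_rv_Lfun1 X : bounded_rv X -> X \in Lfun P 1.
Proof. by move=> bX; apply/Lfun1_integrable; exact: bounded_rv_integrable. Qed.

Lemma variance_mean X : bounded_rv X ->
  fine 'V_P[X]%E = mean (fun w => X w ^+ 2) - mean X ^+ 2.
Proof.
move=> bX; have bXX := bounded_rvM _ _ bX bX.
rewrite /variance covarianceE; [|exact: bounded_rv_Lfun1..].
by rewrite (expectation_mean (X * X))// !expectation_mean// -EFinM -EFinB.
Qed.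

End BoundedRandomVariables.

(** * Negative association through a finite generating function *)

Section OccupancyGeneratingFunction.
Context {R : realType} {m : nat}.
Implicit Types (x a t : 'I_m -> R).

Lemma weierstrass_prod_ge t : (forall i, -1 <= t i) ->
  (forall i j, 0 <= t i * t j) -> 1 + \sum_i t i <= \prod_i (1 + t i).
Proof.
move=> t1 tt.
(* The induction must also carry that each [t i] has the sign of the partial sum, so that the cross
   term is nonnegative. *)
suff [//] : 1 + \sum_i t i <= \prod_i (1 + t i) /\
  forall i, 0 <= t i * \sum_j t j.
elim/big_rec2: _ => [|i u v _ [uv tv]].
  by rewrite addr0; split => // i; rewrite mulr0.
split; last by move=> j; rewrite mulrDr addr_ge0.
have ti : 0 <= 1 + t i by rewrite -lerBlDl sub0r.
apply: le_trans (ler_wpM2l ti uv).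
by have := tv i; nra.
Qed.

(* If each of n draws hits cell k with probability x k, this is the expectation
   of the product over k of 1 + a k 1_{cell k is empty}: expanding the product,
   the cells of A are all empty with probability (1 - \sum_(k in A) x k) ^+ n. *)
Definition empty_gf n x a : R :=
  \sum_(A : {set 'I_m}) (\prod_(k in A) a k) * (1 - \sum_(k in A) x k) ^+ n.

(** A draw in cell [k] makes its factor [1 + a k 1_{empty}] equal to 1, which amounts to replacing
    [a k] by 0. *)
Definition zero_at (k : 'I_m) a : 'I_m -> R := fun i => if i == k then 0 else a i.

Lemma prod1D_subsets a :
  \prod_k (1 + a k) = \sum_(A : {set 'I_m}) \prod_(k in A) a k.
Proof.
under eq_bigr do rewrite addrC.
rewrite bigA_distr; apply: eq_bigr => A _.
by rewrite [RHS]big_mkcond.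
Qed.

Lemma empty_gf0 x a : empty_gf 0 x a = \prod_k (1 + a k).
Proof.
by rewrite prod1D_subsets; apply: eq_bigr => A _; rewrite expr0 mulr1.
Qed.

Lemma prod_zero_at (k : 'I_m) a (A : {set 'I_m}) :
  \prod_(i in A) zero_at k a i = (k \notin A)%:R * \prod_(i in A) a i.
Proof.
case: (boolP (k \in A)) => kA /=.
  by rewrite mul0r (bigD1 k)//= /zero_at eqxx mul0r.
rewrite mul1r; apply: eq_bigr => i iA; rewrite /zero_at.
by case: eqVneq => // ik; rewrite ik (negbTE kA) in iA.
Qed.

(** Conditioning on one draw: it misses all cells or hits exactly one cell [k]. Algebraically, the
    coefficient of a set [A] gains [1 - \sum_k x k] plus the mass outside [A], that is
    [1 - \sum_(k in A) x k]. *)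
Lemma empty_gfS n x a : empty_gf n.+1 x a =
  (1 - \sum_k x k) * empty_gf n x a + \sum_k x k * empty_gf n x (zero_at k a).
Proof.
rewrite /empty_gf; under [X in _ + X]eq_bigr do rewrite mulr_sumr.
rewrite exchange_big/= mulr_sumr -big_split; apply: eq_bigr => A _ /=.
set p := \prod_(k in A) a k; set s := \sum_(k in A) x k.
have E k : x k * ((\prod_(i in A) zero_at k a i) * (1 - s) ^+ n) =
    p * (1 - s) ^+ n * (if k \notin A then x k else 0).
  by rewrite prod_zero_at -/p; case: ifP => _ /=; ring.
rewrite (eq_bigr _ (fun k _ => E k)).
rewrite -mulr_sumr -big_mkcond/= [\sum_k x k](bigID (mem A))/= -/s exprS.
ring.
Qed.

(* Negative association of the empty cells, for both signs of the a k at once: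
   conditioning on one draw reduces it to 1 + \sum t <= \prod (1 + t). *)
Lemma empty_gf_le n x a : (forall k, 0 <= x k) -> \sum_k x k <= 1 ->
  (forall k, -1 < a k) -> (forall i j, 0 <= a i * a j) ->
  empty_gf n x a <= \prod_k (1 + a k * (1 - x k) ^+ n).
Proof.
move=> x0 xs; have x1 k : x k <= 1.
  by apply: le_trans xs; rewrite (bigD1 k)//= lerDl sumr_ge0.
elim: n a => [|n IH] a a1 aa.
  by rewrite empty_gf0; under [leRHS]eq_bigr do rewrite expr0 mulr1.
pose r k := (1 - x k) ^+ n; pose y k := 1 + a k * r k.
have r01 k : 0 <= r k <= 1.
  by rewrite exprn_ge0 ?exprn_ile1 ?subr_ge0// lerBlDr lerDl.
have y0 k : 0 < y k.
  have /andP[r0 r1] := r01 k; rewrite /y -ltrBlDl sub0r.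
  have h : 0 <= (1 + a k) * r k by rewrite mulr_ge0// ltW// -ltrBlDl sub0r.
  have := a1 k; move: r1; rewrite le_eqVlt => /predU1P[->|r1]; last by lra.
  by rewrite mulr1.
have zero_le k : empty_gf n x (zero_at k a) <= (\prod_i y i) / y k.
  apply: le_trans (IH _ _ _) _.
  - by move=> i; rewrite /zero_at; case: ifP.
  - by move=> i j; rewrite /zero_at; do 2 case: ifP; rewrite ?mul0r ?mulr0.
  rewrite (bigD1 k)//= {1}/zero_at eqxx mul0r addr0 mul1r.
  rewrite [X in _ <= X / _](bigD1 k)//= mulrAC divff ?gt_eqF// mul1r.
  rewrite le_eqVlt; apply/orP; left; apply/eqP; apply: eq_bigr => i ik.
  by rewrite /zero_at (negbTE ik).
(* Here [1 + t k] is the quotient of the [k]-th target factor at [n.+1] by that at [n]. Since also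
   [t k = x k / y k - x k], the recurrence and the induction hypothesis bound the left side by
   [(\prod y) * (1 + \sum t)]. *)
pose t k := - (x k * (a k * r k) / y k).
have tE k : 1 + a k * (1 - x k) ^+ n.+1 = y k * (1 + t k).
  by rewrite exprS /t /y -/(r k); field; rewrite gt_eqF// y0.
under [leRHS]eq_bigr do rewrite tE.
rewrite big_split/= empty_gfS.
have Y0 : 0 < \prod_k y k by exact: prodr_gt0.
apply: (@le_trans _ _ ((\prod_k y k) * (1 + \sum_k t k))).
  have xk k : x k * empty_gf n x (zero_at k a) <= x k * ((\prod_i y i) / y k).
    by rewrite ler_wpM2l.
  apply: (@le_trans _ _ ((1 - \sum_k x k) * (\prod_k y k) +
      \sum_k x k * ((\prod_i y i) / y k))).
    by rewrite lerD ?ler_sum// ler_wpM2l ?subr_ge0// IH.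
  rewrite mulrC mulrBr mulr1 mulrDr mulr1 -addrA lerD2l !mulr_sumr -sumrN -big_split.
  rewrite le_eqVlt; apply/orP; left; apply/eqP; apply: eq_bigr => k _ /=.
  by rewrite /t /y; field; rewrite gt_eqF// y0.
rewrite ler_pM2l//; apply: weierstrass_prod_ge.
- move=> k; rewrite /t lerN2 ler_pdivrMr// mul1r.
  have /andP[r0 r1] := r01 k; have := a1 k; have := x0 k; have := x1 k.
  rewrite /y => h1 h2 h3; have h4 : -1 <= a k * r k by nra.
  by nra.
- move=> i j; have /andP[ri _] := r01 i; have /andP[rj _] := r01 j.
  have -> : t i * t j = (a i * a j) * (x i * x j * (r i * r j) / (y i * y j)).
    by rewrite /t; field; rewrite !gt_eqF.
  by rewrite mulr_ge0// divr_ge0 ?mulr_ge0// ltW.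
Qed.

End OccupancyGeneratingFunction.

(** * Exponential moments and variance of a weighted sum of indicators *)

Section WeightedIndicators.
Context {d} {T : measurableType d} {R : realType} (P : probability T R).
Variables (q : nat -> R) (Y : nat -> T -> bool).
Hypotheses (q0 : forall j, 0 <= q j) (q1 : series q @ \oo --> (1 : R)).
Hypothesis mY : forall j, measurable [set w | Y j w].

Let y j (w : T) : R := (Y j w)%:R.
Let r j : R := mean P (y j).

Definition weight (w : T) : R := rsum (fun j => q j * (Y j w)%:R).
(** [weight] lies between [head m] and [head m + tail m] with a deterministic [tail m] tending to 0,
    so finite-sum estimates pass to the limit uniformly in [w]. *)
Let head m (w : T) : R := series (fun j => q j * (Y j w)%:R) m.
Let tail m : R := 1 - series q m.

Lemma dominated_weight w : dominated q (fun j => q j * (Y j w)%:R).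
Proof.
exists 1 => j; rewrite mul1r ger0_norm ?mulr_ge0//.
by rewrite ler_piMr// lern1 leq_b1.
Qed.

Let head_ge0 m w : 0 <= head m w.
Proof. by rewrite /head /series /= sumr_ge0// => j _; rewrite mulr_ge0. Qed.

Let head_le m w : head m w <= weight w.
Proof.
by apply: (le_rsum q) => //; [exact: dominated_weight|move=> j; rewrite mulr_ge0].
Qed.

Let tail_cvg : tail @ \oo --> (0 : R).
Proof. by rewrite -(subrr (1 : R)); apply: cvgB => //; exact: cvg_cst. Qed.

Let tail_ge0 m : 0 <= tail m.
Proof.
by rewrite subr_ge0 -(rsum_pmf q q1) (le_rsum q)//; exact: dominated_self.
Qed.

Let weight_le m w : weight w <= head m w + tail m.
Proof.
have dw := dominated_weight w; have dq := dominated_self q q0.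
have : series (fun j => q j - q j * (Y j w)%:R) m <=
    rsum (fun j => q j - q j * (Y j w)%:R).
  apply: (le_rsum q) => // [|j]; first exact: dominatedB.
  by rewrite subr_ge0 ler_piMr// lern1 leq_b1.
rewrite (rsumB q)// (rsum_pmf q)// /tail /head /weight /series /= sumrB; lra.
Qed.

Lemma weight_ge0 w : 0 <= weight w.
Proof. exact: le_trans (head_ge0 0 w) (head_le 0 w). Qed.

Lemma weight_le1 w : weight w <= 1.
Proof.
by have := weight_le 0 w; rewrite /head /tail /series /= !big_geq// subr0 add0r.
Qed.

Let bounded_y j : bounded_rv (y j). Proof. exact: bounded_rv_bool. Qed.

Let bounded_ind j : bounded_rv (fun w => (Y j w)%:R : R).
Proof. exact: bounded_rv_bool. Qed.

Let bounded_head m : bounded_rv (head m).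
Proof.
apply: bounded_rv_sum => j; apply: bounded_rvZ; exact: bounded_y.
Qed.

#[local] Hint Resolve bounded_y bounded_ind bounded_head bounded_rv_cst : core.

Let head_le1 m w : head m w <= 1.
Proof. exact: le_trans (head_le m w) (weight_le1 w). Qed.

Lemma bounded_weight : bounded_rv weight.
Proof.
split; last by exists 1 => w; rewrite ger0_norm ?weight_ge0 ?weight_le1.
apply/measurable_EFinP.
rewrite (_ : EFin \o weight = fun w => \sum_(0 <= j <oo) (q j * (Y j w)%:R)%:E)%E.
  apply: ge0_emeasurable_sum => [j w _ _|j _]; first by rewrite lee_fin mulr_ge0.
  by apply/measurable_EFinP; have [] := bounded_rvZ (q j) _ (bounded_y j).
apply/funext => w; rewrite (nneseries_rsum q)//; first exact: dominated_weight.
by move=> j; rewrite mulr_ge0.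
Qed.

Let mean_head m : mean P (head m) = series (fun j => q j * r j) m.
Proof.
rewrite /head /series /= mean_sum => [|j]; last exact: bounded_rvZ.
by apply: eq_bigr => j _; rewrite meanZ.
Qed.

Lemma mean_ind_ge0 j : 0 <= r j.
Proof.
by rewrite -(mean_cst P 0); apply: le_mean.
Qed.

Lemma mean_ind_le1 j : r j <= 1.
Proof.
rewrite -(mean_cst P 1); apply: le_mean => //.
by move=> w; rewrite lern1 leq_b1.
Qed.

Let mean_tail m : mean P (fun w => head m w + tail m) = mean P (head m) + tail m.
Proof. by rewrite meanD ?mean_cst//; exact: bounded_rv_cst. Qed.

Let mean_weight_bounds m :
  mean P (head m) <= mean P weight <= mean P (head m) + tail m.
Proof.
rewrite -mean_tail; apply/andP; split; apply: le_mean => //.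
- exact: bounded_weight.
- exact: bounded_weight.
- by apply: bounded_rvD => //; exact: bounded_rv_cst.
Qed.

(** Each factor of the product is bounded by [1 + x <= expR x]; centering removes
    [lambda * q j * r j] from the exponent and leaves the term dominated by [b j]. *)
Lemma mgf_weight_le (lambda : R) (b : nat -> R) :
  (forall m, mean P (fun w => expR (lambda * head m w)) <=
     \prod_(0 <= j < m) (1 + (expR (lambda * q j) - 1) * r j)) ->
  dominated q b -> (forall j, 0 <= b j) ->
  (forall j, r j * (expR (lambda * q j) - 1 - lambda * q j) <= b j) ->
  (lne 'E_P[fun w => expR (lambda * (weight w - fine 'E_P[weight]))] <=
     (rsum b)%:E)%E.
Proof.
move=> mgf db b0 rb; have bw := bounded_weight.
rewrite (expectation_mean P weight)//=; set mu := mean P weight.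
have bX : bounded_rv (fun w => expR (lambda * (weight w - mu))).
  apply/bounded_rv_expR/bounded_rvZ/bounded_rvB => //; exact: bounded_rv_cst.
rewrite (expectation_mean P _ bX).
have X0 : 0 < mean P (fun w => expR (lambda * (weight w - mu))).
  apply: mean_gt0 => //; exists (expR (- (`|lambda| * (1 + `|mu|)))).
    exact: expR_gt0.
  move=> w; rewrite ler_expR lerNl; apply: le_trans (ler_norm _) _.
  rewrite normrN normrM ler_wpM2l// (le_trans (ler_normB _ _))// lerD2r.
  by rewrite ger0_norm ?weight_ge0 ?weight_le1.
rewrite lne_EFin// lee_fin -ler_expR lnK ?posrE//.
(* One [|lambda| * tail m] pays for replacing [weight] by [head m], the other for replacing its
   mean. *)
have step m : mean P (fun w => expR (lambda * (weight w - mu))) <=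
    expR (rsum b + 2 * `|lambda| * tail m).
  have bh : bounded_rv (fun w => expR (lambda * head m w)).
    by apply/bounded_rv_expR/bounded_rvZ.
  apply: (@le_trans _ _ (mean P (fun w =>
      expR (`|lambda| * tail m - lambda * mu) * expR (lambda * head m w)))).
    apply: le_mean => // [|w]; first exact: bounded_rvZ.
    rewrite -expRD ler_expR mulrBr addrAC lerD2r -lerBlDr -mulrBr.
    apply: le_trans (ler_norm _) _; rewrite normrM ler_wpM2l// ger0_norm.
      by have := weight_le m w; lra.
    by rewrite subr_ge0.
  rewrite meanZ// (le_trans (ler_wpM2l _ (mgf m))) ?expR_ge0//.
  apply: (@le_trans _ _ (expR (`|lambda| * tail m - lambda * mu) *
      expR (\sum_(0 <= j < m) (lambda * (q j * r j) + b j)))).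
    rewrite ler_wpM2l ?expR_ge0// expR_sum; apply: ler_prod => j _.
    have e0 := expR_gt0 (lambda * q j).
    have rj0 := mean_ind_ge0 j; have rj1 := mean_ind_le1 j.
    apply/andP; split; first by nra.
    apply: le_trans (expR_ge1Dx _); rewrite lerD2l.
    by have := rb j; lra.
  rewrite -expRD ler_expR big_split/= -mulr_sumr.
  have -> : \sum_(0 <= j < m) q j * r j = mean P (head m) by rewrite mean_head.
  have sb : \sum_(0 <= j < m) b j <= rsum b by exact: (le_rsum q).
  have : lambda * (mean P (head m) - mu) <= `|lambda| * tail m.
    apply: le_trans (ler_norm _) _; rewrite normrM ler_wpM2l// distrC ger0_norm.
      by have /andP[_] := mean_weight_bounds m; rewrite -/mu; lra.
    by rewrite subr_ge0; have /andP[] := mean_weight_bounds m.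
  lra.
have lim : expR (rsum b + 2 * `|lambda| * tail m) @[m --> \oo] --> expR (rsum b).
  apply: continuous_cvg; first exact: continuous_expR.
  rewrite -[X in _ --> X]addr0; apply: cvgD; first exact: cvg_cst.
  rewrite -(mulr0 (2 * `|lambda|)); apply: cvgM => //; exact: cvg_cst.
rewrite -(cvg_lim _ lim)//; apply: limr_ge.
  by apply/cvg_ex; eexists; exact: lim.
exact: nearW.
Qed.

Let variance_head m : mean P (fun w => head m w ^+ 2) - mean P (head m) ^+ 2 =
  \sum_(0 <= i < m) \sum_(0 <= j < m)
    q i * q j * (mean P (fun w => y i w * y j w) - r i * r j).
Proof.
have -> : (fun w => head m w ^+ 2) = (fun w => \sum_(0 <= i < m)
    \sum_(0 <= j < m) q i * q j * (y i w * y j w)).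
  apply/funext => w; rewrite /head /series /= expr2 mulr_suml.
  apply: eq_bigr => i _; rewrite mulr_sumr; apply: eq_bigr => j _.
  by rewrite mulrACA.
have byy i j : bounded_rv (fun w => y i w * y j w) by exact: bounded_rvM.
rewrite mean_sum => [|i]; last by apply: bounded_rv_sum => j; exact: bounded_rvZ.
rewrite mean_head expr2 /series /= mulr_suml -sumrB; apply: eq_bigr => i _.
rewrite mean_sum => [|j]; last exact: bounded_rvZ.
rewrite mulr_sumr -sumrB; apply: eq_bigr => j _.
by rewrite meanZ// mulrBr mulrACA.
Qed.

Let variance_head_cvg :
  mean P (fun w => head m w ^+ 2) - mean P (head m) ^+ 2 @[m --> \oo] -->
  fine 'V_P[weight]%E.
Proof.
have bw := bounded_weight; rewrite variance_mean//.
have mh1 m : 0 <= mean P (head m) <= mean P weight.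
  have /andP[-> _] := mean_weight_bounds m; rewrite andbT.
  rewrite -(mean_cst P 0); apply: le_mean => //; exact: bounded_rv_cst.
have mw1 : mean P weight <= 1.
  rewrite -[leRHS](mean_cst P 1); apply: le_mean => //.
  exact: weight_le1.
have tail2 : 2 * tail m @[m --> \oo] --> (0 : R).
  by rewrite -(mulr0 2); apply: cvgM => //; exact: cvg_cst.
have sq X : bounded_rv X -> bounded_rv (fun w => X w ^+ 2).
  by move=> bX; exact: bounded_rvM.
apply: cvgB; apply/cvgrPdist_le => e e0.
- move/cvgrPdist_le : tail2 => /(_ _ e0); apply: filterS => m.
  rewrite sub0r normrN; apply: le_trans; apply: le_trans (ler_norm _).
  rewrite ger0_norm; last first.
    rewrite subr_ge0; apply: le_mean; [exact: sq..|move=> w].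
    by rewrite lerXn2r ?nnegrE ?head_le ?head_ge0 ?weight_ge0.
  rewrite -meanB; [|exact: sq..]; rewrite -[leRHS](mean_cst P).
  apply: le_mean => [||w]; [by apply: bounded_rvB; exact: sq|exact: bounded_rv_cst|].
  have := weight_le m w; have := head_le m w; have := head_ge0 m w.
  have := weight_le1 w; have := head_le1 m w; have := tail_ge0 m.
  by nra.
- move/cvgrPdist_le : tail2 => /(_ _ e0); apply: filterS => m.
  rewrite sub0r normrN; apply: le_trans; apply: le_trans (ler_norm _).
  have /andP[h0 h1] := mh1 m.
  rewrite ger0_norm; last by rewrite subr_ge0 lerXn2r ?nnegrE// (le_trans h0).
  have /andP[_ h2] := mean_weight_bounds m; have := tail_ge0 m.
  by nra.
Qed.

(** Nonpositive covariances leave at most the diagonal; lower bounds [- K * (c i * c j)] add up to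
    at least minus [K] times a square. *)
Lemma variance_weight_bounds (K : R) (c : nat -> R) : 0 <= K ->
  dominated q (fun j => q j * c j) -> 
  (forall i j, i != j -> r i * r j - K * (c i * c j) <=
     mean P (fun w => y i w * y j w) <= r i * r j) ->
  rsum (fun j => q j ^+ 2 * (r j - r j ^+ 2)) - K * (rsum (fun j => q j * c j)) ^+ 2
    <= fine 'V_P[weight]%E <= rsum (fun j => q j ^+ 2 * (r j - r j ^+ 2)).
Proof.
move=> K0 dqc cov.
have rr j : 0 <= r j - r j ^+ 2 <= 1.
  by have := mean_ind_ge0 j; have := mean_ind_le1 j => ? ?; apply/andP; split; nra.
have dD : dominated q (fun j => q j ^+ 2 * (r j - r j ^+ 2)).
  exists 1 => j; have /andP[h0 h1] := rr j; have h2 := pmf_le1 q q0 q1 j.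
  rewrite mul1r ger0_norm ?mulr_ge0 ?sqr_ge0// expr2 -mulrA ler_piMr//.
  by rewrite mulr_ile1.
have diag i : mean P (fun w => y i w * y i w) - r i * r i = r i - r i ^+ 2.
  rewrite -expr2; congr (_ - _); congr mean; apply/funext => w.
  by rewrite /y; case: (Y i w); rewrite ?mulr1 ?mulr0.
have cD : series (fun j => q j ^+ 2 * (r j - r j ^+ 2)) @ \oo -->
    rsum (fun j => q j ^+ 2 * (r j - r j ^+ 2)) by exact: (rsum_cvg q).
have cC : series (fun j => q j * c j) @ \oo --> rsum (fun j => q j * c j).
  exact: (rsum_cvg q).
have cV := variance_head_cvg.
have row m i : (i < m)%N -> forall f : nat -> nat -> R,
    \sum_(0 <= j < m) f i j = f i i + \sum_(0 <= j < m | j != i) f i j.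
  move=> im f; rewrite (bigD1_seq i)//= ?iota_uniq// mem_index_iota.
  by rewrite leq0n im.
apply/andP; split; last first.
  rewrite -(cvg_lim _ cV)// -(cvg_lim _ cD)//.
  apply: ler_lim; [by apply/cvg_ex; eexists; exact: cV|
    by apply/cvg_ex; eexists; exact: cD|apply: nearW => m].
  rewrite variance_head /series /= !big_nat; apply: ler_sum => i im.
  rewrite (row m i im (fun i j => q i * q j *
     (mean P (fun w => y i w * y j w) - r i * r j))) diag -expr2 gerDl.
  apply: sumr_le0 => j ij; rewrite mulr_ge0_le0 ?mulr_ge0// subr_le0.
  by rewrite eq_sym in ij; have /andP[] := cov _ _ ij.
have cL : series (fun j => q j ^+ 2 * (r j - r j ^+ 2)) m -
    K * (series (fun j => q j * c j) m) ^+ 2 @[m --> \oo] -->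
    rsum (fun j => q j ^+ 2 * (r j - r j ^+ 2)) - K * (rsum (fun j => q j * c j)) ^+ 2.
  by apply: cvgB => //; apply: cvgM; [exact: cvg_cst|apply: cvgM].
rewrite -(cvg_lim _ cV)// -(cvg_lim _ cL)//.
apply: ler_lim; [by apply/cvg_ex; eexists; exact: cL|
  by apply/cvg_ex; eexists; exact: cV|apply: nearW => m].
rewrite variance_head /series /= expr2 mulr_suml mulr_sumr -sumrB.
apply: ler_sum_nat => i im.
rewrite (row m i im (fun i j => q i * q j *
   (mean P (fun w => y i w * y j w) - r i * r j))) diag -expr2 lerD2l.
rewrite mulr_sumr mulr_sumr (row m i im (fun i j => K * (q i * c i * (q j * c j)))).
(* The diagonal terms that complete the square only lower the left side. *)
rewrite opprD -[leRHS]add0r lerD//.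
  rewrite oppr_le0 mulr_ge0// -expr2 sqr_ge0//.
rewrite -sumrN; apply: ler_sum => j ij; rewrite eq_sym in ij.
have /andP[h _] := cov _ _ ij.
have -> : - (K * (q i * c i * (q j * c j))) = q i * q j * - (K * (c i * c j)).
  by ring.
by rewrite ler_wpM2l ?mulr_ge0//; lra.
Qed.

End WeightedIndicators.

(** * Thinning of a Poisson number of trials *)

Section PoissonThinning.
Context {R : realType}.

Lemma nneseries_exp_coeff (x : R) : 0 <= x ->
  (\sum_(0 <= k <oo) (x ^+ k / k`!%:R)%:E = (expR x)%:E)%E.
Proof.
move=> x0; rewrite /expR -EFin_lim; last exact: is_cvg_series_exp_coeff.
by apply: congr_lim; apply/funext => n /=; rewrite sumEFin.
Qed.

Lemma poisson_thinning (t x : R) r : 0 < t -> 0 <= x <= 1 ->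
  (\sum_(0 <= k <oo)
     (poisson_pmf t k * ('C(k, r)%:R * x ^+ r * (1 - x) ^+ (k - r)))%:E =
   (expR (- (t * x)) * ((t * x) ^+ r / r`!%:R))%:E)%E.
Proof.
move=> t0 /andP[x0 x1]; have x1' : 0 <= 1 - x by rewrite subr_ge0.
have f0 k : (0 <= (poisson_pmf t k *
    ('C(k, r)%:R * x ^+ r * (1 - x) ^+ (k - r)))%:E)%E.
  by rewrite lee_fin mulr_ge0 ?poisson_pmf_ge0// !mulr_ge0// exprn_ge0.
rewrite (nneseries_split 0 r)// add0n big_nat big1 ?add0e; last first.
  by move=> k /andP[_ kr]; rewrite bin_small// !mul0r mulr0.
rewrite -nneseries_addn//.
have tx0 : 0 <= t * (1 - x) by rewrite mulr_ge0// ltW.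
rewrite (eq_eseriesr (g := fun i => (expR (- t) * ((t * x) ^+ r / r`!%:R))%:E *
    ((t * (1 - x)) ^+ i / i`!%:R)%:E)%E); last first.
  move=> i _; rewrite -EFinM; congr EFin; rewrite /poisson_pmf t0 addnK.
  have := @bin_fact (i + r) r (leq_addl i r).
  rewrite addnK => /(congr1 (fun n => n%:R : R)).
  rewrite !natrM => binE.
  have fr : r`!%:R != 0 :> R by rewrite pnatr_eq0 -lt0n fact_gt0.
  have fi : i`!%:R != 0 :> R by rewrite pnatr_eq0 -lt0n fact_gt0.
  have fir : (i + r)`!%:R != 0 :> R by rewrite pnatr_eq0 -lt0n fact_gt0.
  have -> : 'C(i + r, r)%:R = (i + r)`!%:R / (r`!%:R * i`!%:R) :> R.
    by rewrite -binE mulfK// mulf_neq0.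
  by rewrite !exprMn exprD; field; rewrite fr fi fir.
rewrite nneseriesZl; last first.
  by move=> i _; rewrite lee_fin divr_ge0 ?exprn_ge0.
rewrite nneseries_exp_coeff// -EFinM; congr EFin.
by rewrite mulrAC -expRD; congr (expR _ * _); ring.
Qed.

Lemma poisson_thinning0 (t x : R) : 0 < t -> 0 <= x <= 1 ->
  (\sum_(0 <= k <oo) (poisson_pmf t k * (1 - x) ^+ k)%:E = (expR (- (t * x)))%:E)%E.
Proof.
move=> t0 x01; have := poisson_thinning _ _ 0 t0 x01.
rewrite expr0 fact0 divr1 mulr1 => <-; apply: eq_eseriesr => k _.
by rewrite bin0 subn0 !mul1r.
Qed.

End PoissonThinning.

(** Induction on [n], splitting over the countably many values of the last draw. The measurable
    space is arbitrary so that the lemma also applies to the sigma-algebra generated by the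
    draws. *)
Lemma measurable_draws {d} {T : measurableType d} (u : nat -> T -> nat) n
    (h : seq nat -> bool) : (forall i k, measurable [set w | u i w = k]) ->
  measurable [set w | h (mkseq (u^~ w) n)].
Proof.
move=> mu; elim: n h => [|n IH] h.
  have -> : [set w | h (mkseq (u^~ w) 0)] = if h [::] then setT else set0.
    by apply/seteqP; split => w /=; case: (h [::]).
  by case: ifP.
have -> : [set w | h (mkseq (u^~ w) n.+1)] = \bigcup_k
    ([set w | h (rcons (mkseq (u^~ w) n) k)] `&` [set w | u n w = k]).
  apply/seteqP; split => w /=; rewrite mkseqS; first by exists (u n w).
  by move=> [k _ /= [hk ->]].
apply: bigcupT_measurable => k; apply: measurableI => //.
exact: (IH (fun s => h (rcons s k))).
Qed.

(** * Laws of the draws with fixed and with Poisson sample size *)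

Section Draws.
Context {d} {T : measurableType d} {R : realType} (P : probability T R).
Variables (p : nat -> R) (U : nat -> {RV P >-> nat}).
Hypotheses (hp : is_pmf p) (hU : iid_draws p U).

Definition draws n (w : T) : seq nat := mkseq (fun i => U i w) n.

Let measurableU i k : measurable [set w | U i w = k].
Proof.
have := @measurable_funP _ _ _ _ setT (U i); move=> /(_ measurableT [set k]).
by rewrite setTI; exact.
Qed.

Lemma measurable_draws_event n (h : seq nat -> bool) :
  measurable [set w | h (draws n w)].
Proof. exact: measurable_draws. Qed.

Lemma draws_independent n (B : nat -> pred nat) :
  mean P (fun w => \prod_(i < n) (B i (U i w))%:R) =
  \prod_(i < n) mean P (fun w => (B i (U i w))%:R).
Proof.
have mB i : measurable [set w | B i (U i w)].
  rewrite (_ : [set _ | _] = \bigcup_(k in [set k | B i k]) [set w | U i w = k]).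
    exact: bigcup_measurable.
  apply/seteqP; split => w /=; first by exists (U i w).
  by move=> [k /= Bk ->].
apply: EFin_inj; rewrite -prodEFin.
under [RHS]eq_bigr do rewrite mean_bool//.
have /(_ (iota 0 n) (fun i => [set k | B i k]) (iota_uniq _ _)) := hU.1.
move=> /(_ (fun=> I)) indep.
rewrite -(big_mkord xpredT (fun i => P [set w | B i (U i w)])) /index_iota subn0.
rewrite -indep.
transitivity (mean P (fun w => ([forall i : 'I_n, B i (U i w)])%:R : R))%:E.
  congr (_%:E); congr mean; apply/funext => w.
  case: forallP => [h|nh]; first by rewrite big1// => i _; rewrite h.
  have [i Bi] : exists i : 'I_n, ~~ B i (U i w).
    by apply/existsP; rewrite -negb_forall; apply/negP => /forallP.
  by rewrite (bigD1 i)//= (negbTE Bi) mul0r.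
have setE : [set w | [forall i : 'I_n, B i (U i w)]] =
    \bigcap_(i in [set` iota 0 n]) (U i @^-1` [set k | B i k]).
  apply/seteqP; split => w /=.
    by move=> /forallP h i /=; rewrite mem_iota add0n => /andP[_ ni];
      exact: (h (Ordinal ni)).
  by move=> h; apply/forallP => i; apply: h => /=; rewrite mem_iota add0n ltn_ord.
rewrite mean_bool ?setE//.
by apply: fin_bigcap_measurable => // i _; exact: mB.
Qed.

Lemma draws_independent_ord n (B : 'I_n -> pred nat) :
  mean P (fun w => \prod_(i < n) (B i (U i w))%:R) =
  \prod_(i < n) mean P (fun w => (B i (U i w))%:R).
Proof.
have := draws_independent n (fun i => oapp B xpredT (insub i)).
rewrite [X in _ = X -> _](eq_bigr (fun i => mean P (fun w => (B i (U i w))%:R))).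
  move=> <-; congr mean; apply/funext => w.
  by apply: eq_bigr => i _; rewrite valK.
by move=> i _; rewrite valK.
Qed.

Let q k : R := p k.+1.

Lemma draw_weight_ge0 k : 0 <= q k.
Proof. exact: hp.1. Qed.

Lemma nneseries_shift1 (f : nat -> \bar R) : (forall j, 0 <= f j.+1)%E ->
  (\sum_(1 <= j <oo) f j = \sum_(0 <= k <oo) f k.+1)%E.
Proof.
(* No sign is known for [f 0]; the function [j |-> f j.-1.+1] agrees with [f] from 1 on and is
   nonnegative everywhere. *)
move=> f0; transitivity (\sum_(1 <= j <oo) f j.-1.+1)%E.
  rewrite eseries_cond [RHS]eseries_cond.
  by apply: eq_eseriesr => j /andP[_]; case: j.
by rewrite -nneseries_addn//; apply: eq_eseriesr => j _; rewrite addn1.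
Qed.

Lemma draw_weight_cvg : series q @ \oo --> (1 : R).
Proof.
have := hp.2; rewrite nneseries_shift1 => [q1|j]; last by rewrite lee_fin hp.1.
have : (\sum_(0 <= k < n) (q k)%:E)%E @[n --> \oo] --> (1 : R)%:E.
  rewrite -q1; apply: is_cvg_nneseries => k _ _; rewrite lee_fin.
  exact: draw_weight_ge0.
move=> /fine_cvgP[_]; apply: cvg_trans; apply: near_eq_cvg; apply: nearW => n.
by rewrite /= sumEFin.
Qed.

Lemma bounded_draws_event n (h : seq nat -> bool) :
  bounded_rv (fun w => (h (draws n w))%:R : R).
Proof. by apply: bounded_rv_bool; exact: measurable_draws_event. Qed.

Lemma bounded_draw i (B : pred nat) : bounded_rv (fun w => (B (U i w))%:R : R).
Proof.
have := bounded_draws_event i.+1 (fun s => B (nth 0%N s i)).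
by under eq_fun do rewrite nth_mkseq//.
Qed.

Lemma mean_hit i k : mean P (fun w => (U i w == k.+1)%:R) = q k.
Proof.
apply: EFin_inj; rewrite mean_bool.
  have [_ hU2] := hU; transitivity (P (U i @^-1` [set k.+1])); last exact: hU2.
  by congr (P _); apply/seteqP; split => w /=; [move/eqP|move=> ->].
rewrite (_ : [set _ | _] = [set w | U i w = k.+1])//.
by apply/seteqP; split => w /=; [move/eqP|move=> ->].
Qed.

Lemma mean_avoid m i (A : {set 'I_m}) :
  mean P (fun w => (~~ [exists k in A, U i w == k.+1])%:R) = 1 - \sum_(k in A) q k.
Proof.
transitivity (mean P (fun w => 1 - \sum_(k in A) (U i w == k.+1)%:R)).
  congr mean; apply/funext => w; case: existsP => [[k /andP[kA /eqP Uk]]|nk] /=.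
    rewrite (bigD1 k)//= Uk eqxx big1 ?addr0 ?subrr// => j /andP[_ jk].
    by rewrite eqSS eq_sym val_eqE (negbTE jk).
  rewrite big1 ?subr0// => k kA; case: eqP => // Uk.
  by case: nk; exists k; rewrite kA Uk eqxx.
have bU k : bounded_rv (fun w => (U i w == k.+1)%:R : R).
  exact: (bounded_draw i (pred1 k.+1)).
rewrite meanB ?mean_cst//; [|exact: bounded_rv_cst|exact: bounded_rv_sum].
by rewrite mean_sum//; congr (_ - _); apply: eq_bigr => k _; exact: mean_hit.
Qed.

Definition avoids {m} (A : {set 'I_m}) (s : seq nat) : bool :=
  [forall k in A, (k : nat).+1 \notin s].

Lemma mean_avoids m n (A : {set 'I_m}) :
  mean P (fun w => (avoids A (draws n w))%:R) = (1 - \sum_(k in A) q k) ^+ n.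
Proof.
transitivity (mean P (fun w =>
    \prod_(i < n) (~~ [exists k in A, U i w == k.+1])%:R)).
  congr mean; apply/funext => w; case: (boolP (avoids A _)) => [/forall_inP av|].
    rewrite big1// => i _; case: existsP => // -[k /andP[kA /eqP Uk]].
    have /negP[] := av _ kA; apply/mapP; exists (i : nat) => //.
    by rewrite mem_iota/=.
  move=> /forall_inPn[k kA]; rewrite negbK => /mapP[i].
  rewrite mem_iota add0n => /andP[_ ni] Uk.
  rewrite (bigD1 (Ordinal ni))//=; case: existsP => [_|[]]; first by rewrite mul0r.
  by exists k; rewrite kA -Uk eqxx.
rewrite (draws_independent n (fun _ u => ~~ [exists k in A, u == k.+1])).
under eq_bigr do rewrite mean_avoid.
by rewrite prodr_const card_ord.
Qed.

(** The event splits according to the set of draws that hit the cell; independence gives every set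
    of size [r] the same probability. *)
Lemma mean_count n k r :
  mean P (fun w => (count_mem k.+1 (draws n w) == r)%:R) =
  'C(n, r)%:R * q k ^+ r * (1 - q k) ^+ (n - r).
Proof.
pose f (A : {set 'I_n}) (w : T) : R :=
  \prod_(i < n) ((U i w == k.+1) == (i \in A))%:R.
have bf A : bounded_rv (f A).
  apply: bounded_rv_prod => i.
  exact: (bounded_draw i (fun u => (u == k.+1) == (i \in A))).
transitivity (mean P (fun w => \sum_(A : {set 'I_n} | #|A| == r) f A w)).
  congr mean; apply/funext => w; pose Aw := [set i : 'I_n | U i w == k.+1]%SET.
  have fE A : f A w = (A == Aw)%:R.
    rewrite /f; case: eqVneq => [->|/eqP AAw].
      by rewrite big1// => i _; rewrite inE eqxx.
    have [i iA] : exists i, (i \in A) != (i \in Aw).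
      apply/existsP; rewrite -negb_forall; apply/negP => /forallP h.
      by apply: AAw; apply/setP => i; exact/eqP.
    have Ui : (U i w == k.+1) = (i \in Aw) by rewrite inE.
    by rewrite (bigD1 i)//= Ui eq_sym (negbTE iA) mul0r.
  have -> : count_mem k.+1 (draws n w) = #|Aw|.
    rewrite count_map -sum1_count -sum1_card -[in LHS](subn0 n) big_mkord.
    by apply: eq_bigl => i; rewrite /= [RHS]inE.
  case: (eqVneq #|Aw| r) => [Awr|Awr] /=.
    rewrite (bigD1 Aw) ?Awr//= fE eqxx big1 ?addr0// => A /andP[_ /negbTE AAw].
    by rewrite fE AAw.
  rewrite big1// => A /eqP Ar; rewrite fE; case: eqP => // AAw.
  by rewrite -AAw Ar eqxx in Awr.
rewrite mean_sum//.
transitivity (\sum_(A : {set 'I_n} | #|A| == r) q k ^+ r * (1 - q k) ^+ (n - r)).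
  apply: eq_bigr => A /eqP Ar.
  rewrite /f (draws_independent_ord n (fun i u => (u == k.+1) == (i \in A))).
  rewrite (eq_bigr (fun i => if i \in A then q k else 1 - q k)); last first.
    move=> i _; case: (i \in A).
      rewrite -(mean_hit i k); congr mean; apply/funext => w.
      by case: (U i w == k.+1).
    have bhit := bounded_draw i (pred1 k.+1).
    have := meanB P _ _ (bounded_rv_cst 1) bhit; rewrite mean_cst mean_hit => <-.
    congr mean; apply/funext => w /=.
    by case: (U i w == k.+1); rewrite ?subrr ?subr0.
  rewrite (bigID (mem A))/=.
  rewrite (eq_bigr (fun=> q k)); last by move=> i ->.
  rewrite [X in _ * X](eq_bigr (fun=> 1 - q k)); last by move=> i /negbTE ->.
  rewrite !prodr_const Ar; congr (_ * _ ^+ _).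
  have nE : n = (r + #|[predC A]|)%N by rewrite -Ar cardC card_ord.
  by rewrite [X in (X - r)%N]nE addKn; apply: eq_card.
rewrite sumr_const -[RHS]mulrA [RHS]mulr_natl; congr (_ *+ _).
have := @card_draws 'I_n r; rewrite card_ord => <-.
by apply: eq_card => A; rewrite inE.
Qed.

(** Stated for an arbitrary random list [D], so that both schemes reduce to the probability that all
    cells of a set are empty. *)
Lemma mean_prod_vacant m (a : 'I_m -> R) (D : T -> seq nat) :
  (forall h : seq nat -> bool, measurable [set w | h (D w)]) ->
  mean P (fun w => \prod_(k < m) (1 + a k * ((k : nat).+1 \notin D w)%:R)) =
  \sum_(A : {set 'I_m})
    (\prod_(k in A) a k) * mean P (fun w => (avoids A (D w))%:R).
Proof.
move=> mD; have bD h : bounded_rv (fun w => (h (D w) : bool)%:R : R).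
  exact: bounded_rv_bool.
transitivity (mean P (fun w => \sum_(A : {set 'I_m})
    (\prod_(k in A) a k) * (avoids A (D w))%:R)).
  congr mean; apply/funext => w; rewrite prod1D_subsets; apply: eq_bigr => A _.
  rewrite big_split/=; congr (_ * _).
  case: (boolP (avoids A _)) => [/forall_inP av|].
    by rewrite big1// => k /av ->.
  by move=> /forall_inPn[k kA /negbTE kD]; rewrite (bigD1 k)//= kD mul0r.
rewrite mean_sum => [|A]; last by apply: bounded_rvZ; exact: bD.
by apply: eq_bigr => A _; rewrite meanZ.
Qed.

Lemma mean_prod_draws m n (a : 'I_m -> R) :
  mean P (fun w => \prod_(k < m) (1 + a k * ((k : nat).+1 \notin draws n w)%:R)) =
  empty_gf n (fun k : 'I_m => q k) a.
Proof.
rewrite mean_prod_vacant; last exact: measurable_draws_event.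
by apply: eq_bigr => A _; rewrite mean_avoids.
Qed.

Section PoissonSize.
Variables (N : {RV P >-> nat}) (t : R).
Hypotheses (t_gt0 : 0 < t).
Hypothesis N_poisson : forall k, P (N @^-1` [set k]) = (poisson_pmf t k)%:E.
Hypothesis N_independent : independent_of_seq N U.

Let measurableN k : measurable [set w | N w = k].
Proof.
have := @measurable_funP _ _ _ _ setT N; move=> /(_ measurableT [set k]).
by rewrite setTI; exact.
Qed.

Definition poisson_draws (w : T) : seq nat := draws (N w) w.

Let poisson_event_bigcup (h : seq nat -> bool) :
  [set w | h (poisson_draws w)] =
  \bigcup_k (N @^-1` [set k] `&` [set w | h (draws k w)]).
Proof.
apply/seteqP; split => w /=; first by exists (N w).
by rewrite /poisson_draws => -[k _ [/= -> ?]].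
Qed.

Lemma measurable_poisson_draws_event (h : seq nat -> bool) :
  measurable [set w | h (poisson_draws w)].
Proof.
rewrite poisson_event_bigcup; apply: bigcupT_measurable => k.
by apply: measurableI; [exact: measurableN|exact: measurable_draws_event].
Qed.

Lemma poisson_mixture (h : seq nat -> bool) :
  (mean P (fun w => (h (poisson_draws w))%:R))%:E =
  (\sum_(0 <= k <oo)
     (poisson_pmf t k * mean P (fun w => (h (draws k w))%:R))%:E)%E.
Proof.
rewrite mean_bool; last exact: measurable_poisson_draws_event.
rewrite poisson_event_bigcup measure_semi_bigcup//.
- apply: eq_eseriesr => k _.
  rewrite EFinM mean_bool; last exact: measurable_draws_event.
  rewrite -N_poisson; apply: N_independent => //.
  (* Independence of the sample size applies to events of [sigma_seq U], so measurability must hold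
     for that smaller sigma-algebra. *)
  pose G := [set A |
    exists i, exists2 B : set nat, measurable B & A = U i @^-1` B].
  apply: (@measurable_draws _ (g_sigma_algebraType G) (fun i w => U i w)) => i j.
  by apply: sub_sigma_algebra; exists i, [set j].
- move=> k; apply: measurableI; first exact: measurableN.
  exact: measurable_draws_event.
- by move=> i j _ _ [w [/= [<- _] [<- _]]].
- rewrite -poisson_event_bigcup; exact: measurable_poisson_draws_event.
Qed.

Let q_le1 k : q k <= 1.
Proof. exact: pmf_le1 draw_weight_ge0 draw_weight_cvg k. Qed.

(** The cells of [A] merge into one cell carrying their total mass. The exponential of the sum then
    factors over [A], which yields the product formula that follows. *)
Lemma mean_poisson_avoids m (A : {set 'I_m}) :
  mean P (fun w => (avoids A (poisson_draws w))%:R) =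
  expR (- (t * \sum_(k in A) q k)).
Proof.
apply: EFin_inj; rewrite poisson_mixture.
under eq_eseriesr do rewrite mean_avoids.
rewrite poisson_thinning0// sumr_ge0 => [/=|k _]; last exact: draw_weight_ge0.
have <- := rsum_pmf q draw_weight_cvg.
have le_q : \sum_(k < m) q k <= rsum q.
  rewrite -(big_mkord xpredT q); apply: (le_rsum q) => //.
  - exact: draw_weight_cvg.
  - exact/dominated_self/draw_weight_ge0.
  - exact: draw_weight_ge0.
apply: le_trans le_q; rewrite [leRHS](bigID (mem A))/= lerDl sumr_ge0// => k _.
exact: draw_weight_ge0.
Qed.

Lemma mean_prod_poisson_draws m (a : 'I_m -> R) :
  mean P (fun w =>
    \prod_(k < m) (1 + a k * ((k : nat).+1 \notin poisson_draws w)%:R)) =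
  \prod_(k < m) (1 + a k * expR (- (t * q k))).
Proof.
rewrite mean_prod_vacant; last exact: measurable_poisson_draws_event.
rewrite prod1D_subsets; apply: eq_bigr => A _; rewrite mean_poisson_avoids.
by rewrite big_split/= -expR_sum mulr_sumr -sumrN.
Qed.

Lemma mean_poisson_count k r :
  mean P (fun w => (count_mem k.+1 (poisson_draws w) == r)%:R) =
  expR (- (t * q k)) * ((t * q k) ^+ r / r`!%:R).
Proof.
apply: EFin_inj; rewrite (poisson_mixture (fun s => count_mem k.+1 s == r)).
under eq_eseriesr do rewrite mean_count.
by rewrite poisson_thinning// draw_weight_ge0 q_le1.
Qed.

End PoissonSize.

End Draws.

(** * Second-order remainders of the exponential *)

Section ExponentialRemainder.
Context {R : realType}.
Implicit Types x u s : R.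

Lemma expR_rem2_le x : x <= 0 -> expR x - 1 - x <= x ^+ 2 / 2.
Proof.
move=> x0; pose f (y : R) := expR y - (1 + y + y ^+ 2 / 2).
pose df (y : R) := expR y - (1 + y).
have fdf (y : R) : is_derive y 1 f (df y).
  by rewrite /f /df; apply: is_derive_eq; rewrite /GRing.scale /=; field.
have [|c /itvP c0 fE] := @MVT_segment _ f df x 0 x0 (fun y _ => fdf y).
  apply: derivable_within_continuous => y _; exact: ex_derive.
have : 0 <= f 0 - f x.
  by rewrite fE mulr_ge0 ?subr_ge0 ?expR_ge1Dx.
by rewrite /f expR0; nra.
Qed.

(** Convexity of [expR] between 0 and [x]: the tangent at [s * x] is evaluated at [x] and at 0, with
    weights [s] and [1 - s]. *)
Lemma expR_scale_le s x : 0 <= s <= 1 -> expR (s * x) <= 1 + s * (expR x - 1).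
Proof.
move=> /andP[s0 s1].
have e0 := expR_gt0 (s * x).
have h1 : expR (s * x) * (1 + (x - s * x)) <= expR x.
  by rewrite -[in leRHS](subrKC (s * x) x) expRD ler_wpM2l ?expR_ge1Dx ?ltW.
have h2 : expR (s * x) * (1 + - (s * x)) <= 1.
  apply: le_trans (ler_wpM2l (ltW e0) (expR_ge1Dx _)) _.
  by rewrite expRxMexpNx_1.
have s1' : 0 <= 1 - s by rewrite subr_ge0.
by have := ler_wpM2l s0 h1; have := ler_wpM2l s1' h2; lra.
Qed.

(** The difference of the two sides vanishes at [u = 0] and, by [expR_scale_le], has a nonnegative
    derivative. *)
Lemma expR_rem2_scale_le s u : 0 <= s <= 1 -> 0 <= u ->
  expR (s * u) - 1 - s * u <= s ^+ 2 * (expR u - 1 - u).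
Proof.
move=> s01 u0; have /andP[s0 s1] := s01.
pose f (y : R) := s ^+ 2 * (expR y - y) - (expR (s * y) - s * y).
pose df (y : R) := s * (s * (expR y - 1) - (expR (s * y) - 1)).
have fdf (y : R) : is_derive y 1 f (df y).
  rewrite /f /df; apply: is_derive_eq.
  by rewrite /GRing.scale /=; ring.
have [|c /itvP c0 fE] := @MVT_segment _ f df 0 u u0 (fun y _ => fdf y).
  apply: derivable_within_continuous => y _; exact: ex_derive.
have : 0 <= f u - f 0.
  rewrite fE mulr_ge0 ?subr_ge0// /df mulr_ge0// subr_ge0 lerBlDl.
  exact: expR_scale_le.
by rewrite /f mulr0 expR0; nra.
Qed.

End ExponentialRemainder.

(** Beyond some [m] the remaining mass is below [y], so no further cell qualifies. The counted set
    is thus finite and [fset_set] does not fall back to its default value. *)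
Lemma counting_nu_series {R : realType} (p : nat -> R) (y : R) :
  (forall k, 0 <= p k.+1) -> series (fun k => p k.+1) @ \oo --> (1 : R) -> 0 < y ->
  (\sum_(0 <= k <oo) ((y <= p k.+1)%R%:R)%:E = (counting_nu p y)%:E)%E.
Proof.
move=> p0 p1 y0.
have [m _ mP] : \forall m \near \oo, 1 - series (fun k => p k.+1) m < y.
  move/cvgrPdist_lt : p1 => /(_ _ y0); apply: filterS => m.
  by apply: le_lt_trans; exact: ler_norm.
have small k : (m <= k)%N -> (y <= p k.+1) = false.
  move=> mk; apply/negbTE; rewrite -ltNge; apply: le_lt_trans (mP _ mk).
  rewrite lerBrDr addrC -[leLHS](_ : series (fun k => p k.+1) k.+1 = _); last first.
    by rewrite /series /= big_nat_recr.
  have := rsum_pmf _ p1; rewrite -[leRHS]/(1 : R) => <-.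
  by apply: (le_rsum (fun k => p k.+1)) => //; exact: dominated_self.
pose s := [seq k.+1 | k <- iota 0 m & y <= p k.+1].
have setE : [set j : nat | (1 <= j)%N /\ y <= p j] = [set` s].
  apply/seteqP; split => j /=.
    move=> [j1 yj]; apply/mapP; exists j.-1; rewrite ?prednK//.
    rewrite mem_filter prednK// yj mem_iota/= add0n ltnNge; apply/negP => mj.
    by have := small _ mj; rewrite prednK// yj.
  by move=> /mapP[k]; rewrite mem_filter => /andP[yk _] ->.
have -> : counting_nu p y = (size s)%:R.
  rewrite /counting_nu setE; congr (_%:R); apply: perm_size; apply: uniq_perm.
  - exact: fset_uniq.
  - by rewrite map_inj_uniq ?filter_uniq ?iota_uniq//; exact: succn_inj.
  - move=> j; have fs : finite_set [set` s] by exact: finite_seq.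
    by rewrite (in_fset_set fs) mem_setE.
rewrite (nneseries_split 0 m)//= add0n eseries0 ?adde0; last first.
  by move=> k mk _; rewrite small.
rewrite sumEFin size_map size_filter -sum1_count natr_sum; congr EFin.
by rewrite [RHS]big_mkcond/= /index_iota subn0; apply: eq_bigr => k _; case: ifP.
Qed.

(** * Tail bounds common to both schemes *)

Section VacancyTails.
Context {d} {T : measurableType d} {R : realType} (P : probability T R).
Variables (q : nat -> R) (D : T -> seq nat) (n : nat).
Hypotheses (q0 : forall j, 0 <= q j) (q1 : series q @ \oo --> (1 : R)).
Hypothesis n_gt0 : (0 < n)%N.
Hypothesis mD : forall h : seq nat -> bool, measurable [set w | h (D w)].

Definition vacant j (w : T) : bool := j.+1 \notin D w.

Hypothesis vacant_le : forall j,
  mean P (fun w => (vacant j w)%:R) <= expR (- (n%:R * q j)).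
Hypothesis vacant_prod_le : forall m (a : 'I_m -> R),
  (forall k, -1 < a k) -> (forall i j, 0 <= a i * a j) ->
  mean P (fun w => \prod_(k < m) (1 + a k * (vacant k w)%:R)) <=
  \prod_(k < m) (1 + a k * mean P (fun w => (vacant k w)%:R)).

Let mvacant j : measurable [set w | vacant j w].
Proof. exact: (mD (fun s => j.+1 \notin s)). Qed.

Let nR : 0 < n%:R :> R. Proof. by rewrite ltr0n. Qed.

Lemma vacancy_mgf_le (lambda : R) (b : nat -> R) :
  dominated q b -> (forall j, 0 <= b j) ->
  (forall j,
    expR (- (n%:R * q j)) * (expR (lambda * q j) - 1 - lambda * q j) <= b j) ->
  (lne 'E_P[fun w =>
      expR (lambda * (weight q vacant w - fine 'E_P[weight q vacant]))]
     <= (rsum b)%:E)%E.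
Proof.
move=> db b0 hb; apply: mgf_weight_le => // [m|j]; last first.
  apply: le_trans (hb j); rewrite ler_wpM2r//.
  by have := expR_ge1Dx (lambda * q j); lra.
have -> : (fun w => expR (lambda * series (fun j => q j * (vacant j w)%:R) m)) =
    (fun w => \prod_(k < m) (1 + (expR (lambda * q k) - 1) * (vacant k w)%:R)).
  apply/funext => w; rewrite /series /= mulr_sumr expR_sum big_mkord.
  apply: eq_bigr => k _; case: (vacant k w).
    by rewrite !mulr1 addrC subrK.
  by rewrite !mulr0 expR0 addr0.
(* The weights [expR (lambda * q k) - 1] exceed -1 and all share the sign of [lambda]. *)
rewrite big_mkord; apply: vacant_prod_le => [k|i j].
  by rewrite ltrBrDr addNr expR_gt0.
have [l0|l0] := leP 0 lambda.
  by rewrite mulr_ge0// subr_ge0 -expR0 ler_expR mulr_ge0.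
by rewrite mulr_le0// subr_le0 expR_le1 mulr_le0_ge0// ltW.
Qed.

Let bw : bounded_rv (weight q vacant).
Proof. exact: bounded_weight. Qed.

Lemma vacancy_sub_gaussian_left :
  sub_gaussian_left P (weight q vacant) (sq_sum q n%:R).
Proof.
split=> [|lambda l0]; first exact: bounded_rv_integrable.
have dG : dominated q (fun j => q j ^+ 2 * expR (- (n%:R * q j))).
  by apply: dominated_sq_exp => //; exact: ltW.
have -> : sq_sum q n%:R * lambda ^+ 2 / 2 =
    rsum (fun j => lambda ^+ 2 / 2 * (q j ^+ 2 * expR (- (n%:R * q j)))).
  by rewrite (rsumZ q)// /sq_sum; ring.
apply: vacancy_mgf_le => [|j|j]; first exact: dominatedZ.
  by rewrite mulr_ge0 ?divr_ge0 ?sqr_ge0// mulr_ge0 ?sqr_ge0 ?expR_ge0.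
have h := expR_rem2_le (lambda * q j) (mulr_le0_ge0 l0 (q0 j)).
apply: le_trans (ler_wpM2l (expR_ge0 _) h) _.
by rewrite le_eqVlt; apply/orP; left; apply/eqP; ring.
Qed.

Lemma vacancy_sub_gamma_right :
  sub_gamma_right P (weight q vacant) (2 * ge2_sum q n%:R / n%:R ^+ 2) (1 / n%:R).
Proof.
split=> [|lambda l0]; first exact: bounded_rv_integrable.
rewrite !div1r invrK => ln.
have dH : dominated q (fun j => ptail2 (n%:R * q j)).
  by apply: dominated_ptail2 => //; exact: ltW.
pose s := lambda / n%:R.
have s0 : 0 <= s by rewrite divr_ge0// ltW.
have s1 : s < 1 by rewrite ltr_pdivrMr// mul1r.
have H0 : 0 <= ge2_sum q n%:R.
  by apply: (rsum_ge0 q) => // j; rewrite ptail2_ge0// mulr_ge0// ltW.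
(* The quantity [s ^+ 2 * ge2_sum] equals [lambda^2 * v / 2]; division by [1 - s], which lies in
   []0, 1]], only enlarges it. *)
apply: (@le_trans _ _ (s ^+ 2 * ge2_sum q n%:R)%:E); last first.
  rewrite lee_fin.
  have -> : lambda ^+ 2 * (2 * ge2_sum q n%:R / n%:R ^+ 2) /
      (2 * (1 - n%:R^-1 * lambda)) =
      (s ^+ 2 * ge2_sum q n%:R) / (1 - s).
    rewrite /s mulrC [_ * lambda]mulrC; field.
    by rewrite (gt_eqF nR) subr_eq0 (gt_eqF ln).
  rewrite ler_pdivlMr ?subr_gt0// ler_piMr ?mulr_ge0 ?sqr_ge0//.
  by rewrite lerBlDr lerDl.
rewrite /ge2_sum -(rsumZ q)//.
apply: vacancy_mgf_le => [|j|j]; first exact: dominatedZ.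
  by rewrite mulr_ge0 ?sqr_ge0// ptail2_ge0// mulr_ge0// ltW.
have u0 : 0 <= n%:R * q j by rewrite mulr_ge0// ltW.
have := @expR_rem2_scale_le _ s (n%:R * q j); rewrite s0 (ltW s1) => /(_ isT u0).
have -> : s * (n%:R * q j) = lambda * q j by rewrite /s mulrA divfK// gt_eqF.
move=> h; apply: le_trans (ler_wpM2l (expR_ge0 _) h) _.
rewrite mulrCA ler_wpM2l ?sqr_ge0//.
have e1 : expR (- (n%:R * q j)) * expR (n%:R * q j) = 1.
  by rewrite mulrC expRxMexpNx_1.
by rewrite /ptail2 !mulrBr e1; lra.
Qed.

End VacancyTails.

Lemma count_mem_eq0 (x : nat) (s : seq nat) :
  (count_mem x s == 0%N) = (x \notin s).
Proof. exact: sameP eqP count_memPn. Qed.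

(** * The urn scheme: variance factors, tails and variance *)

Section UrnScheme.
Context {d} {T : measurableType d} {R : realType} (P : probability T R).
Variables (p : nat -> R) (U : nat -> {RV P >-> nat}) (N : R -> {RV P >-> nat}).
Hypotheses (hp : is_pmf p) (hU : iid_draws p U) (hN : poisson_sizes U N).

Local Notation q := (fun k => p k.+1).

Let q0 k : 0 <= q k. Proof. exact: draw_weight_ge0. Qed.
Let q1 : series q @ \oo --> (1 : R). Proof. exact: draw_weight_cvg. Qed.
#[local] Hint Resolve q0 q1 : core.

Lemma occupancyE n j w : occupancy U n j w = count_mem j (draws P U n w).
Proof.
rewrite /occupancy /draws count_map -sum1_count -[in RHS](subn0 n) big_mkord.
by rewrite [RHS]big_mkcond; apply: eq_bigr => i _ /=; case: eqP.
Qed.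

Let missing_weight (D : T -> seq nat) w :
  fine (\sum_(1 <= j <oo) (p j * (count_mem j (D w) == 0%N)%:R)%:E)%E =
  weight q (vacant D) w.
Proof.
rewrite nneseries_shift1 => [|j]; last by rewrite lee_fin mulr_ge0// q0.
rewrite (eq_eseriesr (g := fun k => (q k * (vacant D k w)%:R)%:E)); last first.
  by move=> k _; rewrite count_mem_eq0.
rewrite (nneseries_rsum q)//; first exact: dominated_weight.
by move=> k; rewrite mulr_ge0// q0.
Qed.

Lemma missing_massE n : missing_mass p U n = weight q (vacant (draws P U n)).
Proof.
apply/funext => w; rewrite -missing_weight /missing_mass; congr fine.
by apply: eq_eseriesr => j _; rewrite occupancyE.
Qed.

Lemma poisson_missing_massE t :
  poisson_missing_mass p U N t = weight q (vacant (poisson_draws P U (N t))).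
Proof.
apply/funext => w; rewrite -missing_weight /poisson_missing_mass; congr fine.
by apply: eq_eseriesr => j _; rewrite /poisson_occupancy occupancyE.
Qed.

Lemma integral_event_series (h : nat -> T -> bool) :
  (forall k, measurable [set w | h k w]) ->
  (\int[P]_w \sum_(0 <= k <oo) ((h k w)%:R)%:E =
   \sum_(0 <= k <oo) (mean P (fun w => (h k w)%:R))%:E)%E.
Proof.
move=> mh.
have bh k : bounded_rv (fun w => (h k w)%:R : R) by exact: bounded_rv_bool.
rewrite integral_nneseries//.
- by apply: eq_eseriesr => k _; rewrite -expectation_mean// unlock.
- by move=> k; apply/measurable_EFinP; have [] := bh k.
Qed.

Section FixedSize.
Variable n : nat.
Hypothesis n_gt0 : (0 < n)%N.
Let nR : 0 < n%:R :> R. Proof. by rewrite ltr0n. Qed.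
Let Npois := (hN _ nR).1.
Let Nindep := (hN _ nR).2.
Local Notation D := (poisson_draws P U (N n%:R)).

Let mean_D k r := mean_poisson_count P p U hp hU _ _ nR Npois Nindep k r.

Let mD (h : seq nat -> bool) : measurable [set w | h (D w)].
Proof. exact: measurable_poisson_draws_event. Qed.

Lemma v_minusE : v_minus U N n = sq_sum q n%:R.
Proof.
have -> : v_minus U N n = 2 * fine (\sum_(0 <= k <oo)
    (n%:R ^+ 2 / 2 * (q k ^+ 2 * expR (- (n%:R * q k))))%:E)%E / n%:R ^+ 2.
  rewrite /v_minus; congr (_ * fine _ / _).
  transitivity (\int[P]_w \sum_(0 <= k <oo) ((count_mem k.+1 (D w) == 2%N)%:R)%:E)%E.
    apply: eq_integral => w _; rewrite /poisson_K nneseries_shift1//.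
    by apply: eq_eseriesr => k _; rewrite /poisson_occupancy occupancyE.
  rewrite integral_event_series => [|k]; last first.
    exact: (mD (fun s => count_mem k.+1 s == 2%N)).
  apply: eq_eseriesr => k _; rewrite mean_D; congr EFin.
  by rewrite (_ : 2`!%:R = 2)//; field.
have dG : dominated q (fun j => q j ^+ 2 * expR (- (n%:R * q j))).
  by apply: dominated_sq_exp => //; exact: ltW.
rewrite (nneseries_rsum q)//=; [|exact: dominatedZ|]; last first.
  by move=> k; rewrite mulr_ge0 ?divr_ge0 ?sqr_ge0// mulr_ge0 ?sqr_ge0 ?expR_ge0.
rewrite (rsumZ q)// /sq_sum; field.
by rewrite gt_eqF.
Qed.

Lemma v_plusE : v_plus U N n = 2 * ge2_sum q n%:R / n%:R ^+ 2.
Proof.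
rewrite /v_plus; congr (_ * _ / _).
have dH : dominated q (fun j => ptail2 (n%:R * q j)).
  by apply: dominated_ptail2 => //; exact: ltW.
transitivity (fine (\sum_(0 <= k <oo) (ptail2 (n%:R * q k))%:E)%E); last first.
  rewrite (nneseries_rsum q)// => k; rewrite ptail2_ge0// mulr_ge0//; exact: ltW.
congr fine.
transitivity (\int[P]_w \sum_(0 <= k <oo) ((2 <= count_mem k.+1 (D w))%N%:R)%:E)%E.
  apply: eq_integral => w _; rewrite /poisson_Kge nneseries_shift1//.
  by apply: eq_eseriesr => k _; rewrite /poisson_occupancy occupancyE.
rewrite integral_event_series => [|k]; last first.
  exact: (mD (fun s => 2 <= count_mem k.+1 s)%N).
apply: eq_eseriesr => k _; congr EFin.
have bc r : bounded_rv (fun w => (count_mem k.+1 (D w) == r)%:R : R).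
  by apply: bounded_rv_bool; exact: (mD (fun s => count_mem k.+1 s == r)).
have -> : (fun w => (2 <= count_mem k.+1 (D w))%N%:R) = (fun w =>
    1 - ((count_mem k.+1 (D w) == 0%N)%:R + (count_mem k.+1 (D w) == 1%N)%:R) : R).
  apply/funext => w; case: (count_mem k.+1 (D w)) => [|[|c]] /=.
  - by rewrite addr0 subrr.
  - by rewrite add0r subrr.
  - by rewrite addr0 subr0.
rewrite meanB ?mean_cst; [|exact: bounded_rv_cst|exact: bounded_rvD].
rewrite meanD// !mean_D /ptail2 expr0 expr1.
by rewrite (_ : 0`! = 1)%N// (_ : 1`! = 1)%N// !divr1; ring.
Qed.

Lemma mean_vacant_draws k :
  mean P (fun w => (vacant (draws P U n) k w)%:R) = (1 - q k) ^+ n.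
Proof.
have := mean_count P p U hU n k 0; rewrite bin0 subn0 expr0 !mul1r => <-.
by congr mean; apply/funext => w; rewrite count_mem_eq0.
Qed.

Lemma mean_vacant_poisson_draws k :
  mean P (fun w => (vacant D k w)%:R) = expR (- (n%:R * q k)).
Proof.
have := mean_D k 0; rewrite expr0 fact0 divr1 mulr1 => <-.
by congr mean; apply/funext => w; rewrite count_mem_eq0.
Qed.

Let q_le1 k : q k <= 1. Proof. exact: (pmf_le1 q). Qed.

Let sum_q_le1 m (A : {set 'I_m}) : \sum_(k in A) q k <= 1.
Proof.
rewrite -(rsum_pmf q q1); apply: (@le_trans _ _ (\sum_(k < m) q k)).
  by rewrite [leRHS](bigID (mem A))/= lerDl sumr_ge0.
rewrite -(big_mkord xpredT q); apply: (le_rsum q) => //.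
exact: dominated_self.
Qed.

Lemma missing_mass_tails :
  sub_gaussian_left P (missing_mass p U n) (v_minus U N n) /\
  sub_gamma_right P (missing_mass p U n) (v_plus U N n) (1 / n%:R).
Proof.
rewrite missing_massE v_minusE v_plusE.
have mdr (h : seq nat -> bool) : measurable [set w | h (draws P U n w)].
  exact: measurable_draws_event.
have le_v j :
    mean P (fun w => (vacant (draws P U n) j w)%:R) <= expR (- (n%:R * q j)).
  by rewrite mean_vacant_draws onem_exp_le.
have prod_v m (a : 'I_m -> R) :
    (forall k, -1 < a k) -> (forall i j, 0 <= a i * a j) ->
    mean P (fun w => \prod_(k < m) (1 + a k * (vacant (draws P U n) k w)%:R)) <=
    \prod_(k < m) (1 + a k * mean P (fun w => (vacant (draws P U n) k w)%:R)).
  move=> a1 aa; rewrite (mean_prod_draws P p U hU).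
  under [leRHS]eq_bigr do rewrite mean_vacant_draws.
  apply: empty_gf_le => //.
  apply: le_trans (sum_q_le1 m [set: 'I_m]%SET).
  by rewrite le_eqVlt; apply/orP; left; apply/eqP; apply: eq_bigl => k; rewrite inE.
by split; [exact: vacancy_sub_gaussian_left|exact: vacancy_sub_gamma_right].
Qed.

Lemma poisson_missing_mass_tails :
  sub_gaussian_left P (poisson_missing_mass p U N n%:R) (v_minus U N n) /\
  sub_gamma_right P (poisson_missing_mass p U N n%:R) (v_plus U N n) (1 / n%:R).
Proof.
rewrite poisson_missing_massE v_minusE v_plusE.
have le_v j : mean P (fun w => (vacant D j w)%:R) <= expR (- (n%:R * q j)).
  by rewrite mean_vacant_poisson_draws.
have prod_v m (a : 'I_m -> R) :
    (forall k, -1 < a k) -> (forall i j, 0 <= a i * a j) ->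
    mean P (fun w => \prod_(k < m) (1 + a k * (vacant D k w)%:R)) <=
    \prod_(k < m) (1 + a k * mean P (fun w => (vacant D k w)%:R)).
  move=> _ _; rewrite (mean_prod_poisson_draws P p U hp hU _ _ nR Npois Nindep).
  by under [leRHS]eq_bigr do rewrite mean_vacant_poisson_draws.
by split; [exact: vacancy_sub_gaussian_left|exact: vacancy_sub_gamma_right].
Qed.

Lemma mean_vacant_pair i j : i != j ->
  mean P (fun w => (vacant (draws P U n) i w)%:R * (vacant (draws P U n) j w)%:R) =
  (1 - (q i + q j)) ^+ n.
Proof.
move=> ij; pose m := (maxn i j).+1.
have im : (i < m)%N by rewrite ltnS leq_maxl.
have jm : (j < m)%N by rewrite ltnS leq_maxr.
pose A := [set Ordinal im; Ordinal jm]%SET.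
have := mean_avoids P p U hU m n A.
rewrite big_setU1 ?inE//= big_set1/= => <-; congr mean; apply/funext => w.
rewrite -natrM mulnb; congr (_%:R); congr nat_of_bool; apply/andP/forall_inP.
  by move=> [vi vj] k; rewrite !inE => /orP[] /eqP ->.
by move=> h; split; [apply: (h (Ordinal im))|apply: (h (Ordinal jm))];
  rewrite !inE eqxx ?orbT.
Qed.

(** For distinct cells the covariance is [a^n - b^n] with [a = 1 - q i - q j],
    [b = (1 - q i) * (1 - q j)] and [b - a = q i * q j]. It lies between [- n * q i * q j * b^(n-1)]
    and 0, and the lower bound factors as [- n * (c i * c j)]. Since [\sum q c <= 4 * G n], squaring
    gives the 16. *)
Lemma variance_missing_mass_bounds :
  rsum (fun j => q j ^+ 2 * ((1 - q j) ^+ n - (1 - q j) ^+ n ^+ 2)) -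
    16 * (n%:R * sq_sum q n%:R) * sq_sum q n%:R
  <= fine 'V_P[missing_mass p U n]%E <=
  rsum (fun j => q j ^+ 2 * ((1 - q j) ^+ n - (1 - q j) ^+ n ^+ 2)).
Proof.
rewrite missing_massE.
have mdr k : measurable [set w | vacant (draws P U n) k w].
  exact: (measurable_draws_event P U n (fun s => k.+1 \notin s)).
pose c k := q k * (1 - q k) ^+ n.-1.
have c_le k : q k * c k <= 4 * (q k ^+ 2 * expR (- (n%:R * q k))).
  rewrite /c mulrA -expr2 [leRHS]mulrCA ler_wpM2l ?sqr_ge0//.
  exact: onem_exp_pred_le.
have onem0 k : 0 <= 1 - q k by rewrite subr_ge0.
have qc0 k : 0 <= q k * c k by rewrite /c !mulr_ge0// exprn_ge0.
have dG : dominated q (fun j => q j ^+ 2 * expR (- (n%:R * q j))).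
  by apply: dominated_sq_exp => //; exact: ltW.
have dc : dominated q (fun j => q j * c j).
  apply: dominated_le (dominatedZ _ 4 _ dG) _ => j.
  by rewrite !ger0_norm// (le_trans _ (c_le j)).
have cov i j : i != j ->
   (1 - q i) ^+ n * (1 - q j) ^+ n - n%:R * (c i * c j) <=
   mean P (fun w => (vacant (draws P U n) i w)%:R * (vacant (draws P U n) j w)%:R) <=
   (1 - q i) ^+ n * (1 - q j) ^+ n.
  move=> ij; rewrite mean_vacant_pair// -exprMn.
  set a := 1 - (q i + q j); set b := (1 - q i) * (1 - q j).
  have a0 : 0 <= a.
    pose m := (maxn i j).+1.
    have im : (i < m)%N by rewrite ltnS leq_maxl.
    have jm : (j < m)%N by rewrite ltnS leq_maxr.
    have := sum_q_le1 m [set Ordinal im; Ordinal jm]%SET.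
    by rewrite big_setU1 ?inE//= big_set1/= subr_ge0.
  have b0 : 0 <= b by rewrite mulr_ge0.
  have abE : b - a = q i * q j by rewrite /a /b; ring.
  have ab : a <= b by rewrite -subr_ge0 abE mulr_ge0.
  apply/andP; split; last by rewrite lerXn2r.
  have cE : c i * c j = q i * q j * b ^+ n.-1 by rewrite /c /b exprMn; ring.
  have := exprnB_le _ _ n a0 ab; rewrite abE cE.
  (* The power bound carries a factor [b] to be cancelled, so [b = 0] is treated apart; there
     [b ^+ n = 0] because [n > 0]. *)
  move: b0; rewrite le_eqVlt => /predU1P[<-|b0].
    rewrite expr0n (gtn_eqF n_gt0) => _.
    apply: (@le_trans _ _ 0); last exact: exprn_ge0.
    by rewrite /= sub0r oppr_le0 !mulr_ge0// exprn_ge0.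
  rewrite -[in b ^+ n](prednK n_gt0) exprS => h.
  rewrite lerBlDr -lerBlDl -(ler_pM2l b0); apply: le_trans h _.
  by rewrite le_eqVlt; apply/orP; left; apply/eqP; ring.
pose r k := mean P (fun w => (vacant (draws P U n) k w)%:R).
have rE k : r k = (1 - q k) ^+ n by exact: mean_vacant_draws.
have {}cov i j : i != j -> r i * r j - n%:R * (c i * c j) <=
   mean P (fun w => (vacant (draws P U n) i w)%:R * (vacant (draws P U n) j w)%:R) <=
   r i * r j by rewrite !rE; exact: cov.
have := variance_weight_bounds P q _ q0 q1 mdr n%:R c (ler0n _ _) dc cov.
have -> : (fun j => q j ^+ 2 * (r j - r j ^+ 2)) =
    (fun j => q j ^+ 2 * ((1 - q j) ^+ n - (1 - q j) ^+ n ^+ 2)).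
  by apply/funext => j; rewrite rE.
move=> /andP[lo ->]; rewrite andbT; apply: le_trans lo; rewrite lerD2l lerN2.
have E0 : 0 <= rsum (fun j => q j * c j) by apply: (rsum_ge0 q).
have E4 : rsum (fun j => q j * c j) <= 4 * sq_sum q n%:R.
  by rewrite /sq_sum -(rsumZ q)//; apply: (rsum_le q) => //; exact: dominatedZ.
have -> : 16 * (n%:R * sq_sum q n%:R) * sq_sum q n%:R =
  n%:R * (4 * sq_sum q n%:R) ^+ 2 by ring.
by rewrite ler_wpM2l// lerXn2r ?nnegrE// (le_trans E0).
Qed.

End FixedSize.

End UrnScheme.

Theorem theorem4p1 (d : measure_display) (T : measurableType d) (R : realType)
    (P : probability T R) (p : nat -> R) (U : nat -> {RV P >-> nat})
    (N : R -> {RV P >-> nat}) (alpha : R)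
    (hp : is_pmf p) (hU : iid_draws p U) (hN : poisson_sizes U N)
    (halpha : 0 < alpha < 1) (hnu : nu_regularly_varying p alpha) :
  (forall n : nat, (1 <= n)%N ->
     [/\ sub_gaussian_left P (missing_mass p U n) (v_minus U N n),
         sub_gamma_right P (missing_mass p U n) (v_plus U N n) (1 / n%:R),
         sub_gaussian_left P (poisson_missing_mass p U N n%:R) (v_minus U N n)
       & sub_gamma_right P (poisson_missing_mass p U N n%:R)
           (v_plus U N n) (1 / n%:R)]) /\
  [/\ (v_minus U N n / fine 'V_P[missing_mass p U n]) @[n --> \oo]
        --> 1 / (1 - 2 `^ (alpha - 2)),
      (v_plus U N n / fine 'V_P[missing_mass p U n]) @[n --> \oo]
        --> 2 / (alpha * (1 - 2 `^ (alpha - 2)))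
    & (v_minus U N n / v_plus U N n) @[n --> \oo] --> alpha / 2].
Proof.
split=> [n n1|].
  have [ml mr] := missing_mass_tails P p U N hp hU hN n n1.
  by have [pl pr] := poisson_missing_mass_tails P p U N hp hU hN n n1.
have /andP[a0 a1] := halpha; have [ell sv nu1] := hnu.
pose q k := p k.+1.
have q0 k : 0 <= q k by exact: draw_weight_ge0.
have q1 : series q @ \oo --> (1 : R) by exact: draw_weight_cvg.
have cntE y : 0 < y ->
    (\sum_(0 <= j <oo) ((y <= q j)%R%:R)%:E = (counting_nu p y)%:E)%E.
  exact: counting_nu_series.
have cnt_rv a : 0 < a ->
    counting_nu p (1 / (a * x)) / counting_nu p (1 / x) @[x --> +oo] --> a `^ alpha.
  exact: (regularly_varying_ratio (fun x => counting_nu p (1 / x)) ell).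
pose G := fun n : nat => sq_sum q n%:R; pose H := fun n : nat => ge2_sum q n%:R.
have HG : n%:R ^+ 2 * G n / H n @[n --> \oo] --> alpha.
  exact: nat_cvg_pinfty (sq_sum_ratio_cvg _ _ _ q0 q1 cntE a0 cnt_rv).
have G_gt0 : \forall n \near \oo, 0 < G n.
  exact: near_nat_pinfty (sq_sum_near_gt0 _ _ _ q0 q1 cntE a0 cnt_rv).
have H_gt0 : \forall n \near \oo, 1 <= H n.
  exact: near_nat_pinfty (ge2_sum_cvgy _ _ _ q0 q1 cntE a0 cnt_rv 1).
have dbl : (2 * n)%N @[n --> \oo] --> \oo.
  move=> A [m _ mA]; exists m => // k mk; apply: mA.
  exact: leq_trans mk (leq_pmull _ _).
pose c : R := 1 - 2 `^ (alpha - 2).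
have c_gt0 : 0 < c.
  rewrite subr_gt0 /powR pnatr_eq0/= expR_lt1 nmulr_rlt0 ?ln_gt0 ?ltr1n//.
  by rewrite subr_lt0 (lt_trans a1)// ltr1n.
have VG : fine 'V_P[missing_mass p U n]%E / G n @[n --> \oo] --> c.
  (* The diagonal part of the variance is [B n - B (2 * n)], because squaring [(1 - q j) ^+ n]
     doubles the exponent. *)
  pose B n := rsum (fun j => q j ^+ 2 * (1 - q j) ^+ n).
  have BG : B n / G n @[n --> \oo] --> (1 : R).
    exact: (sq_sum_onem_cvg _ _ _ q0 q1 cntE a0 cnt_rv).
  have B2G : B (2 * n)%N / G n @[n --> \oo] --> (2 : R) `^ (alpha - 2).
    have G2 : G (2 * n)%N / G n @[n --> \oo] --> (2 : R) `^ (alpha - 2).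
      have := nat_cvg_pinfty _ _
        (sq_sum_scale_cvg _ _ _ q0 q1 cntE a0 cnt_rv 2 (ltr0n _ 2)).
      by under eq_fun do rewrite -natrM.
    have BG2 : B (2 * n)%N / G (2 * n)%N @[n --> \oo] --> (1 : R).
      exact: (cvg_comp (fun n => (2 * n)%N) (fun n => B n / G n) dbl BG).
    have : B (2 * n)%N / G (2 * n)%N * (G (2 * n)%N / G n) @[n --> \oo] -->
        1 * (2 : R) `^ (alpha - 2) by exact: cvgM.
    rewrite mul1r; apply: cvg_trans; apply: near_eq_cvg.
    near=> n; rewrite /= mulrA divfK// gt_eqF//; near: n; exact: dbl G_gt0.
  (* After division by [G n], the covariance error is [16 * (n * G n)], which tends to 0. *)
  have lo : (B n - B (2 * n)%N) / G n - 16 * (n%:R * G n) @[n --> \oo] --> c.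
    rewrite -[c]subr0 -(mulr0 16); apply: cvgB.
      by under eq_fun do rewrite mulrBl; apply: cvgB.
    by apply: cvgM; [exact: cvg_cst|exact: sq_sum_linear_cvg0].
  have up : (B n - B (2 * n)%N) / G n @[n --> \oo] --> c.
    by under eq_fun do rewrite mulrBl; apply: cvgB.
  apply: squeeze_cvgr lo up; near=> n.
  have n0 : (0 < n)%N by near: n; exact: nbhs_infty_gt.
  have Gn : 0 < G n by near: n.
  have := variance_missing_mass_bounds P p U hp hU n n0.
  have dB m : dominated q (fun j => q j ^+ 2 * (1 - q j) ^+ m).
    exact: dominated_sq_onem.
  have -> : rsum (fun j =>
        p j.+1 ^+ 2 * ((1 - p j.+1) ^+ n - (1 - p j.+1) ^+ n ^+ 2)) =
      B n - B (2 * n)%N.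
    rewrite /B -(rsumB q)//; congr rsum; apply/funext => j.
    by rewrite -exprM mulnC mulrBr.
  move=> /andP[loV upV]; rewrite ler_pM2r ?invr_gt0// upV andbT.
  by rewrite ler_pdivlMr// mulrBl divfK ?gt_eqF.
have V_G : G n / fine 'V_P[missing_mass p U n]%E @[n --> \oo] --> c^-1.
  by under eq_fun do rewrite -invf_div; apply: cvgV => //; exact: lt0r_neq0.
have H_G : H n / (n%:R ^+ 2 * G n) @[n --> \oo] --> alpha^-1.
  by under eq_fun do rewrite -invf_div; apply: cvgV => //; exact: lt0r_neq0.
have vmE : \forall n \near \oo, v_minus U N n = G n.
  by near=> n; apply: v_minusE => //; near: n; exact: nbhs_infty_gt.
have vpE : \forall n \near \oo, v_plus U N n = 2 * H n / n%:R ^+ 2.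
  by near=> n; apply: v_plusE => //; near: n; exact: nbhs_infty_gt.
split.
- rewrite div1r; apply: cvg_trans V_G; apply: near_eq_cvg.
  by near=> n; congr (_ / _); apply/esym; near: n.
- have -> : 2 / (alpha * c) = 2 * alpha^-1 * c^-1 by rewrite invfM mulrA.
  have : 2 * (H n / (n%:R ^+ 2 * G n)) * (G n / fine 'V_P[missing_mass p U n]%E)
      @[n --> \oo] --> 2 * alpha^-1 * c^-1.
    by apply: cvgM => //; apply: cvgM => //; exact: cvg_cst.
  apply: cvg_trans; apply: near_eq_cvg.
  near=> n; have -> : v_plus U N n = 2 * H n / n%:R ^+ 2 by near: n.
  have Gn : 0 < G n by near: n.
  have n0 : (0 < n)%N by near: n; exact: nbhs_infty_gt.
  rewrite mulrA [RHS]mulrC [LHS]mulrC; congr (_ * _).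
  by rewrite /=; field; rewrite (gt_eqF Gn) pnatr_eq0 -lt0n n0.
- have : n%:R ^+ 2 * G n / H n * 2^-1 @[n --> \oo] --> alpha / 2.
    by apply: cvgM => //; exact: cvg_cst.
  apply: cvg_trans; apply: near_eq_cvg.
  near=> n; have -> : v_plus U N n = 2 * H n / n%:R ^+ 2 by near: n.
  have -> : v_minus U N n = G n by near: n.
  have Hn : 0 < H n by apply: (lt_le_trans ltr01); near: n.
  have n0 : (0 < n)%N by near: n; exact: nbhs_infty_gt.
  by rewrite /=; field; rewrite (gt_eqF Hn) pnatr_eq0 -lt0n n0.
Unshelve. all: by end_near. Qed.
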